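(* Let $\mathsf{A}$ be causal multi-head self-attention with RoPE as defined in the context, let $\mathbf{X}\in\mathbb{R}^{d\times N}$, and denote $$\Delta_h=\Big(10\mathsf{u}_q+5\mathsf{u}_a+\gamma_{MM}(d_{head})+2\gamma_{MM}(d)\Big)2d_{head}^{-1/2}\,\big\||\mathbf{W}_{K,h}|\big\|_{\infty,2}\big\||\mathbf{W}_{Q,h}|\big\|_{\infty,2}$$ for every $1\le h\le n_{head}$. The value of $\mathsf{A}(\mathbf{X})$ computed in floating-point arithmetic satisfies $$\|\mathsf{fl}(\mathsf{A}(\mathbf{X}))-\mathsf{A}(\mathbf{X})\|_{1,\infty}\le\Big(6\mathsf{u}_q+2\gamma_{MM}(d)+\gamma_{MM}(N)+3\mathsf{u}_w+\gamma_{MM}(N,\mathsf{u}_w)+\max_h\tilde\kappa_h(\mathsf{S})\Delta_h\|\mathbf{X}\|_{1,\infty}^2+\mathcal{O}\big(\mathsf{u}_q^2+\mathsf{u}_q^2\|\mathbf{X}\|_{1,\infty}^2\big)\Big)\|\mathbf{W}_O\|_{\infty,\infty}\max_h\|\mathbf{W}_{V,h}\|_{\infty,\infty}\|\mathbf{X}\|_{1,\infty},$$ where $\tilde\kappa_h(\mathsf{S})=\max_{1\le n\le N}\|\mathbf{J}_{\mathsf{S}}(\mathbf{b}_{h,n})\|_{\infty,1}$.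
   Context: Self-attention. Let $d=n_{head}d_{head}$ with $d_{head}$ even and $\mathbf{W}_Q,\mathbf{W}_K,\mathbf{W}_V,\mathbf{W}_O\in\mathbb{R}^{d\times d}$. Split the rows of $\mathbf{W}_Q,\mathbf{W}_K,\mathbf{W}_V$ into $n_{head}$ consecutive blocks $\mathbf{W}_{Q,h},\mathbf{W}_{K,h},\mathbf{W}_{V,h}\in\mathbb{R}^{d_{head}\times d}$. The RoPE matrix $\mathbf{R}_n\in\mathbb{R}^{d_{head}\times d_{head}}$ is block diagonal with $2\times2$ rotation blocks of angles $n\omega_k$, $\omega_k=\tau^{-2k/d_{head}}$, $k=0,\dots,d_{head}/2-1$ ($\tau\in\mathbb{N}$ fixed). For $\mathbf{X}=[\mathbf{x}_1\cdots\mathbf{x}_N]$ let $\mathbf{q}_{h,n}=\mathbf{W}_{Q,h}\mathbf{x}_n$, $\mathbf{k}_{h,n}=\mathbf{W}_{K,h}\mathbf{x}_n$, $\mathbf{v}_{h,n}=\mathbf{W}_{V,h}\mathbf{x}_n$; let $\mathbf{b}_{h,n}\in\mathbb{R}^n$ have $t$th entry $d_{head}^{-1/2}(\mathbf{R}_t\mathbf{k}_{h,t})^\top\mathbf{R}_n\mathbf{q}_{h,n}$, $1\le t\le n$; let $\mathbf{a}_{h,n}=[\mathbf{v}_{h,1}\cdots\mathbf{v}_{h,n}]\,\mathsf{S}(\mathbf{b}_{h,n})$, where $\mathsf{S}(\mathbf{b})_i=\exp(b_i)/\sum_j\exp(b_j)$ is softmax with Jacobian $\mathbf{J}_{\mathsf{S}}$.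 The $n$th column of $\mathsf{A}(\mathbf{X})$ is $\mathbf{W}_O[\mathbf{a}_{1,n}^\top\cdots\mathbf{a}_{n_{head},n}^\top]^\top$. $\|\cdot\|_{p,q}$ is the $\ell_p\to\ell_q$ operator norm (so $\|\mathbf{X}\|_{1,\infty}=\max_{i,j}|x_{i,j}|$); $|\cdot|$ is the entrywise absolute value. Floating-point model. Unit round-offs $\mathsf{u}_w\le\mathsf{u}_a\ll\mathsf{u}_q$ (working, accumulation, quantisation). A matrix product with $\mathbf{W}\in\mathbb{R}^{m\times k}$, $\mathbf{Y}\in\mathbb{R}^{k\times n}$ is computed with error $|\mathsf{fl}(\mathbf{W}\mathbf{Y})-\mathbf{W}\mathbf{Y}|\le(\gamma_{MM}(k)+\gamma(2,\mathsf{u}_q)+\gamma_{MM}(k)\gamma(2,\mathsf{u}_q))|\mathbf{W}||\mathbf{Y}|$, where $\gamma(n,\mathsf{u})=n\mathsf{u}/(1-n\mathsf{u})$, $\gamma_{MM}(k)=\gamma_{MM}(k,\mathsf{u}_a)$, and $\gamma_{MM}(k,\mathsf{u})\ge0$ is a summation-algorithm-dependent constant, nondecreasing in $k$ and of first order in $\mathsf{u}$ (e.g. $\gamma(k,\mathsf{u})$ for recursive summation). Algorithm (each step acts on computed results of previous ones): $\mathbf{q},\mathbf{k},\mathbf{v}$ are computed as matrix products; the (exactly given) RoPE matrices are applied block by block, a matrix-vector product with inner dimension 2 and error bound $(2\mathsf{u}_q+2\mathsf{u}_a+\mathcal{O}(\mathsf{u}_q^2))|\mathbf{R}_n||\cdot|$;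 the products $(\mathbf{R}_t\mathbf{k}_{h,t})^\top\mathbf{R}_n\mathbf{q}_{h,n}$ are computed as matrix products with inner dimension $d_{head}$ and scaled by $d_{head}^{-1/2}$ with relative error at most $\mathsf{u}_a$; softmax is evaluated by the unshifted algorithm, with $|\mathsf{fl}(\mathsf{S}(\mathbf{b}))-\mathsf{S}(\mathbf{b})|\le(3\mathsf{u}_w+\gamma_{MM}(n,\mathsf{u}_w)+\mathcal{O}(\mathsf{u}_w^2))\mathsf{S}(\mathbf{b})$ for $\mathbf{b}\in\mathbb{R}^n$; $\mathbf{a}_{h,n}$ and the multiplication by $\mathbf{W}_O$ are computed as matrix products. $\mathcal{O}(\cdot)$ is as $\mathsf{u}_q\to0$ with the data fixed. *)

(* Defs.v *)
From HB Require Import structures.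
From mathcomp Require Import all_boot all_order all_algebra.
From mathcomp Require Import all_classical all_reals all_analysis.
Set Implicit Arguments.
Unset Strict Implicit.
Unset Printing Implicit Defensive.
Import Order.TTheory GRing.Theory Num.Theory.
Import numFieldNormedType.Exports.
Local Open Scope classical_set_scope.
Local Open Scope ring_scope.

(* Meaningful for 1 <= p <= +oo only. *)
Definition lpnorm (R : realType) (n : nat) (p : \bar R) (x : 'cV[R]_n) : R :=
  match p with
  | EFin r => (\sum_(i < n) `|x i 0| `^ r) `^ r^-1
  | +oo%E => \big[Num.max/0]_(i < n) `|x i 0|
  | -oo%E => 0
  end.

(* Operator norm from l_p to l_q. *)
Definition opnorm (R : realType) (m n : nat) (p q : \bar R) (A : 'M[R]_(m, n)) : R :=
  sup [set lpnorm q (A *m x) | x in [set x : 'cV[R]_n | lpnorm p x <= 1]].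

Definition mxabs (R : realType) (m n : nat) (A : 'M[R]_(m, n)) : 'M[R]_(m, n) :=
  map_mx Num.norm A.

(* Heads and positions are counted from 0, so that the
    position written n in the mathematics is n.+1 here, and the vectors
    attached to n : 'I_N have length n.+1. *)

Definition softmax (R : realType) (n : nat) (b : 'cV[R]_n) : 'cV[R]_n :=
  \col_i (expR (b i 0) / \sum_j expR (b j 0)).

(* 'J acts on row vectors by right multiplication, hence the transpositions. *)
Definition softmax_jacobian (R : realType) (n : nat) (b : 'cV[R]_n) : 'M[R]_n :=
  ('J (fun v : 'rV[R]_n => (softmax v^T)^T) b^T)^T.

Lemma block_index_subproof (nhead dhead : nat) (h : 'I_nhead) (i : 'I_dhead) :
  (h * dhead + i < nhead * dhead)%N.
Proof.
have /leq_trans : (h * dhead + i < h.+1 * dhead)%N by rewrite mulSnr ltn_add2l.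
by apply; rewrite leq_mul2r ltn_ord orbT.
Qed.

Definition block_index (nhead dhead : nat) (h : 'I_nhead) (i : 'I_dhead) :
    'I_(nhead * dhead) :=
  Ordinal (block_index_subproof h i).

Definition row_block (R : realType) (nhead dhead m : nat)
    (W : 'M[R]_(nhead * dhead, m)) (h : 'I_nhead) : 'M[R]_(dhead, m) :=
  rowsub (block_index h) W.

Lemma block_head_subproof (nhead dhead : nat) (i : 'I_(nhead * dhead)) :
  (i %/ dhead < nhead)%N.
Proof.
have dhead_gt0 : (0 < dhead)%N by case: dhead i => // -[i]; rewrite muln0.
by rewrite ltn_divLR.
Qed.

Lemma block_pos_subproof (nhead dhead : nat) (i : 'I_(nhead * dhead)) :
  (i %% dhead < dhead)%N.
Proof. by rewrite ltn_mod; case: dhead i => // -[i]; rewrite muln0. Qed.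

(* Matrix whose nth column stacks a h n over the heads h. *)
Definition stack_heads (R : realType) (nhead dhead N : nat)
    (a : 'I_nhead -> 'I_N -> 'cV[R]_dhead) : 'M[R]_(nhead * dhead, N) :=
  \matrix_(i, n) a (Ordinal (block_head_subproof i)) n (Ordinal (block_pos_subproof i)) 0.

Definition rope_freq (R : realType) (tau dhead k : nat) : R :=
  tau%:R `^ (- ((2 * k)%N%:R / dhead%:R)).

(* Blocks [cos, - sin; sin, cos] on the index pairs (2k, 2k+1). *)
Definition rope (R : realType) (tau dhead n : nat) : 'M[R]_dhead :=
  \matrix_(i, j)
    (let theta := n%:R * rope_freq R tau dhead i./2 in
     if i./2 != j./2 then 0
     else if odd i == odd j then cos theta
     else if odd i then sin theta else - sin theta).

Definition rope_cols (R : realType) (tau dhead N : nat) (Y : 'M[R]_(dhead, N)) :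
    'M[R]_(dhead, N) :=
  \matrix_(i, n) (rope R tau dhead n.+1 *m col n Y) i 0.

(* The first n.+1 columns, i.e. the positions visible from n. *)
Definition causal (R : realType) (m N : nat) (n : 'I_N) (Y : 'M[R]_(m, N)) :
    'M[R]_(m, n.+1) :=
  colsub (widen_ord (ltn_ord n)) Y.

Definition scores (R : realType) (tau dhead d N : nat)
    (WQh WKh : 'M[R]_(dhead, d)) (X : 'M[R]_(d, N)) (n : 'I_N) : 'cV[R]_n.+1 :=
  (Num.sqrt dhead%:R)^-1 *:
    ((causal n (rope_cols tau (WKh *m X)))^T *m col n (rope_cols tau (WQh *m X))).

Definition head_output (R : realType) (tau dhead d N : nat)
    (WQh WKh WVh : 'M[R]_(dhead, d)) (X : 'M[R]_(d, N)) (n : 'I_N) : 'cV[R]_dhead :=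
  causal n (WVh *m X) *m softmax (scores tau WQh WKh X n).

Definition attention (R : realType) (tau nhead dhead N : nat)
    (WQ WK WV WO : 'M[R]_(nhead * dhead)) (X : 'M[R]_(nhead * dhead, N)) :
    'M[R]_(nhead * dhead, N) :=
  WO *m stack_heads (fun h n =>
    head_output tau (row_block WQ h) (row_block WK h) (row_block WV h) X n).

(* The floating-point model does not determine the computed quantities: each
   step is a relation between its (already computed) inputs and its possible
   outputs. *)

Definition gamma (R : realType) (n : nat) (u : R) : R := n%:R * u / (1 - n%:R * u).

(* Bounds on gammaMM are only required for small u, with a threshold that may
   depend on k: gamma itself is negative for u > k^-1. *)
Definition summation_constant (R : realType) (gammaMM : nat -> R -> R) : Prop :=
  [/\ forall k, \forall u \near 0^'+, 0 <= gammaMM k u,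
      forall k l, (k <= l)%N -> \forall u \near 0^'+, gammaMM k u <= gammaMM l u
    & forall k, (gammaMM k : R -> R^o) =O_ (0^'+) (id : R -> R^o)].

Definition second_order (R : realType) (rho : R -> R) : Prop :=
  (rho : R -> R^o) =O_ (0^'+) ((fun u => u ^+ 2) : R -> R^o).

Definition product_within (R : realType) (m k n : nat) (c : R)
    (A : 'M[R]_(m, k)) (B : 'M[R]_(k, n)) (C : 'M[R]_(m, n)) : Prop :=
  forall i j, `|C i j - (A *m B) i j| <= c * (mxabs A *m mxabs B) i j.

Definition mm_constant (R : realType) (gammaMM : nat -> R -> R) (ua uq : R) (k : nat) : R :=
  gammaMM k ua + gamma 2 uq + gammaMM k ua * gamma 2 uq.

Definition fl_mm (R : realType) (gammaMM : nat -> R -> R) (ua uq : R) (m k n : nat)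
    (A : 'M[R]_(m, k)) (B : 'M[R]_(k, n)) (C : 'M[R]_(m, n)) : Prop :=
  product_within (mm_constant gammaMM ua uq k) A B C.

Definition fl_rope (R : realType) (rho_rope : R -> R) (ua uq : R) (tau dhead N : nat)
    (Y Z : 'M[R]_(dhead, N)) : Prop :=
  forall n : 'I_N,
    product_within (2 * uq + 2 * ua + rho_rope uq)
      (rope R tau dhead n.+1) (col n Y) (col n Z).

Definition fl_scale (R : realType) (ua : R) (n : nat) (c : R) (s b : 'cV[R]_n) : Prop :=
  forall i, `|b i 0 - c * s i 0| <= ua * `|c * s i 0|.

Definition fl_softmax (R : realType) (gammaMM rho_softmax : nat -> R -> R) (uw : R)
    (n : nat) (b p : 'cV[R]_n) : Prop :=
  forall i, `|p i 0 - softmax b i 0| <=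
    (3 * uw + gammaMM n uw + rho_softmax n uw) * softmax b i 0.

Definition fl_head (R : realType) (gammaMM : nat -> R -> R) (rho_rope : R -> R)
    (rho_softmax : nat -> R -> R) (uw ua uq : R) (tau dhead d N : nat)
    (WQh WKh WVh : 'M[R]_(dhead, d)) (X : 'M[R]_(d, N))
    (a : 'I_N -> 'cV[R]_dhead) : Prop :=
  exists Q K V RQ RK : 'M[R]_(dhead, N),
  exists s b p : forall n : 'I_N, 'cV[R]_n.+1,
    fl_mm gammaMM ua uq WQh X Q /\
    fl_mm gammaMM ua uq WKh X K /\
    fl_mm gammaMM ua uq WVh X V /\
    fl_rope rho_rope ua uq tau Q RQ /\
    fl_rope rho_rope ua uq tau K RK /\
    forall n : 'I_N,
      [/\ fl_mm gammaMM ua uq (causal n RK)^T (col n RQ) (s n),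
          fl_scale ua (Num.sqrt dhead%:R)^-1 (s n) (b n),
          fl_softmax gammaMM rho_softmax uw (b n) (p n)
        & fl_mm gammaMM ua uq (causal n V) (p n) (a n)].

(* Y is a possible computed value of attention tau WQ WK WV WO X. *)
Definition fl_attention (R : realType) (gammaMM : nat -> R -> R) (rho_rope : R -> R)
    (rho_softmax : nat -> R -> R) (uw ua uq : R) (tau nhead dhead N : nat)
    (WQ WK WV WO : 'M[R]_(nhead * dhead)) (X Y : 'M[R]_(nhead * dhead, N)) : Prop :=
  exists a : 'I_nhead -> 'I_N -> 'cV[R]_dhead,
    (forall h, fl_head gammaMM rho_rope rho_softmax uw ua uq tau
                 (row_block WQ h) (row_block WK h) (row_block WV h) X (a h)) /\
    fl_mm gammaMM ua uq WO (stack_heads a) Y.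

Definition Delta (R : realType) (gammaMM : nat -> R -> R) (ua uq : R) (nhead dhead : nat)
    (WQ WK : 'M[R]_(nhead * dhead)) (h : 'I_nhead) : R :=
  (10 * uq + 5 * ua + gammaMM dhead ua + 2 * gammaMM (nhead * dhead)%N ua)
  * (2 * (Num.sqrt dhead%:R)^-1)
  * opnorm +oo 2%:E (mxabs (row_block WK h))
  * opnorm +oo 2%:E (mxabs (row_block WQ h)).

Definition kappa_softmax (R : realType) (tau nhead dhead N : nat)
    (WQ WK : 'M[R]_(nhead * dhead)) (X : 'M[R]_(nhead * dhead, N)) (h : 'I_nhead) : R :=
  \big[Num.max/0]_(n < N)
    opnorm +oo 1%:E (softmax_jacobian (scores tau (row_block WQ h) (row_block WK h) X n)).

(* Main.v *)
(** Call a computed quantity a perturbation of the exact one, relative to an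
    entrywise bound [U] with factor [e], when it differs from it by at most
    [e * U]; under a product with relative error [c] the factors compound to
    [(1 + a) (1 + b) (1 + c) - 1].  Following the algorithm, the scores are
    perturbed relative to [(|R_t| |W_K| |x_t|)^T |R_n| |W_Q| |x_n|]; each [|R_n|]
    has row and column sums at most [sqrt 2], hence spectral norm at most
    [sqrt 2], which is the origin of the factor 2 in [Delta].  Softmax satisfies
    [|S(b + e) - S(b) - J e|_1 <= 16 t^2] for [|e|_oo <= t <= 1/2], so the score
    error [delta] contributes [kappa delta + 16 delta^2] to the l_1 error of the
    attention weights.  All the resulting factors have the form
    [f + O(u^2)] with [f = O(u)], a form stable under compounding, and the
    first-order parts add up to the announced bound. *)

Require Import Defs.
From mathcomp Require Import all_boot all_order all_algebra.
From mathcomp Require Import all_classical all_reals all_analysis.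
From mathcomp Require Import ring lra.
Import Order.TTheory GRing.Theory Num.Theory.
Import numFieldNormedType.Exports.
Set Implicit Arguments.
Unset Strict Implicit.
Unset Printing Implicit Defensive.
Local Open Scope classical_set_scope.
Local Open Scope ring_scope.

(** * Vector norms and operator norms *)

Lemma lpnorm_ge0 (R : realType) (n : nat) (p : \bar R) (x : 'cV[R]_n) :
  0 <= lpnorm p x.
Proof.
by case: p => [r| |] //=; [exact: powR_ge0 | exact: bigmax_ge_id].
Qed.

Lemma le_lpnorm (R : realType) (n : nat) (p : \bar R) (x y : 'cV[R]_n) :
  (0 < p)%E -> (forall i, `|x i 0| <= y i 0) -> lpnorm p x <= lpnorm p y.
Proof.
case: p => [r r0|_|//] hxy; last first.
  by apply: le_bigmax2 => i _; exact: le_trans (hxy i) (ler_norm _).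
rewrite lte_fin in r0; have r0' := ltW r0; apply: ge0_ler_powR; rewrite ?nnegrE ?invr_ge0//.
- by apply: sumr_ge0 => i _; exact: powR_ge0.
- by apply: sumr_ge0 => i _; exact: powR_ge0.
apply: ler_sum => i _; apply: ge0_ler_powR; rewrite ?nnegrE//.
exact: le_trans (hxy i) (ler_norm _).
Qed.

Lemma lpnormZ (R : realType) (n : nat) (p : \bar R) (a : R) (x : 'cV[R]_n) :
  (0 < p)%E -> lpnorm p (a *: x) = `|a| * lpnorm p x.
Proof.
case: p => [r r0|_|//] /=.
  rewrite lte_fin in r0.
  under eq_bigr => i _ do rewrite mxE normrM powRM//.
  rewrite -mulr_sumr powRM ?powR_ge0//; last first.
    by apply: sumr_ge0 => i _; exact: powR_ge0.
  by rewrite -powRrM mulfV ?gt_eqF// powRr1.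
under eq_bigr => i _ do rewrite mxE normrM.
apply/eqP; rewrite eq_le; apply/andP; split.
  apply: bigmax_le => [|i _]; first by rewrite mulr_ge0// bigmax_ge_id.
  by rewrite ler_wpM2l// le_bigmax.
have [->|a0] := eqVneq a 0; first by rewrite normr0 mul0r bigmax_ge_id.
rewrite mulrC -ler_pdivlMr ?normr_gt0//.
apply: bigmax_le => [|i _]; first by rewrite divr_ge0// bigmax_ge_id.
by rewrite ler_pdivlMr ?normr_gt0// mulrC (le_bigmax _ (fun i => `|a| * `|x i 0|)).
Qed.

Lemma lpnorm0 (R : realType) (n : nat) (p : \bar R) :
  (0 < p)%E -> lpnorm p (0 : 'cV[R]_n) = 0.
Proof. by move=> p0; rewrite -[X in lpnorm _ X](scale0r 0) lpnormZ// normr0 mul0r. Qed.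

Lemma entry_le_lpnorm (R : realType) (n : nat) (p : \bar R) (x : 'cV[R]_n) i :
  (0 < p)%E -> `|x i 0| <= lpnorm p x.
Proof.
case: p => [r r0|_|//] /=; last by rewrite (le_bigmax _ (fun i => `|x i 0|)).
rewrite lte_fin in r0; have r0' := ltW r0.
rewrite -[leLHS]powRr1// -[X in _ `^ X](@mulfV _ r) ?gt_eqF// powRrM.
apply: ge0_ler_powR; rewrite ?nnegrE ?invr_ge0 ?powR_ge0//.
  by apply: sumr_ge0 => j _; exact: powR_ge0.
by rewrite (bigD1 i)//= lerDl; apply: sumr_ge0 => j _; exact: powR_ge0.
Qed.

Lemma lpnorm1E (R : realType) (n : nat) (x : 'cV[R]_n) :
  lpnorm 1%:E x = \sum_i `|x i 0|.
Proof.
rewrite /= invr1 powRr1; last by apply: sumr_ge0 => i _; exact: powR_ge0.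
by apply: eq_bigr => i _; rewrite powRr1.
Qed.

Lemma sqr_lpnorm2 (R : realType) (n : nat) (x : 'cV[R]_n) :
  lpnorm 2%:E x ^+ 2 = \sum_i x i 0 ^+ 2.
Proof.
have s0 : 0 <= \sum_i `|x i 0| `^ 2.
  by apply: sumr_ge0 => i _; exact: powR_ge0.
rewrite /= powR12_sqrt// sqr_sqrtr//.
by apply: eq_bigr => i _; rewrite powR_mulrn// real_normK ?num_real.
Qed.

(** The supremum in [opnorm] is meaningful only over a bounded set. Vectors of the unit ball have
    entries at most 1, so [A *m x] lies below the absolute row sums of [A]. *)
Lemma opnorm_has_ubound (R : realType) (m n : nat) (p q : \bar R)
    (A : 'M[R]_(m, n)) : (0 < p)%E -> (0 < q)%E ->
  has_ubound [set lpnorm q (A *m x) | x in [set x : 'cV[R]_n | lpnorm p x <= 1]].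
Proof.
move=> p0 q0; exists (lpnorm q (\col_i \sum_j `|A i j|)) => _ [x /= xp <-].
apply: le_lpnorm => // i; rewrite !mxE; apply: le_trans (ler_norm_sum _ _ _) _.
apply: ler_sum => j _; rewrite normrM ler_piMr//.
exact: le_trans (entry_le_lpnorm x j p0) xp.
Qed.

Lemma lpnorm_mulmx_le (R : realType) (m n : nat) (p q : \bar R)
    (A : 'M[R]_(m, n)) (x : 'cV[R]_n) : (0 < p)%E -> (0 < q)%E ->
  lpnorm q (A *m x) <= opnorm p q A * lpnorm p x.
Proof.
move=> p0 q0; have [x0|x0] := eqVneq (lpnorm p x) 0.
  have -> : x = 0.
    apply/matrixP => i j; rewrite ord1 mxE; apply/eqP.
    by rewrite -normr_le0 -x0; exact: entry_le_lpnorm.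
  by rewrite mulmx0 !lpnorm0// mulr0.
have xp : 0 < lpnorm p x by rewrite lt_neqAle eq_sym x0 lpnorm_ge0.
rewrite -ler_pdivrMr// mulrC -[_^-1]ger0_norm ?invr_ge0 ?lpnorm_ge0//.
rewrite -lpnormZ// scalemxAr; apply: ub_le_sup; first exact: opnorm_has_ubound.
exists ((lpnorm p x)^-1 *: x) => //=.
by rewrite lpnormZ// ger0_norm ?invr_ge0 ?lpnorm_ge0// mulVf.
Qed.

Lemma opnorm_ge0 (R : realType) (m n : nat) (p q : \bar R) (A : 'M[R]_(m, n)) :
  (0 < p)%E -> (0 < q)%E -> 0 <= opnorm p q A.
Proof.
move=> p0 q0; apply: (le_trans (lpnorm_ge0 q (A *m 0))).
apply: ub_le_sup; first exact: opnorm_has_ubound.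
by exists 0 => //=; rewrite lpnorm0.
Qed.

Lemma entry_le_opnorm (R : realType) (m n : nat) (A : 'M[R]_(m, n)) i j :
  `|A i j| <= opnorm 1%:E +oo A.
Proof.
have := lpnorm_mulmx_le A (delta_mx j 0) (@lte01 R) (ltry 0).
rewrite lpnorm1E (bigD1 j)//= big1 => [|k kj]; last first.
  by rewrite mxE (negbTE kj) normr0.
rewrite mxE !eqxx normr1 addr0 mulr1; apply: le_trans.
by apply: le_trans (entry_le_lpnorm _ i (ltry 0)); rewrite -colE mxE.
Qed.

Lemma opnorm_1oo_le (R : realType) (m n : nat) (A : 'M[R]_(m, n)) (B : R) :
  0 <= B -> (forall i j, `|A i j| <= B) -> opnorm 1%:E +oo A <= B.
Proof.
move=> B0 AB; apply: ge_sup => [|_ [x /= + <-]].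
  by exists (lpnorm +oo (A *m 0)), 0 => //; rewrite /mkset lpnorm0.
rewrite -/(lpnorm 1%:E x) lpnorm1E => x1; apply: bigmax_le => // i _.
rewrite mxE; apply: le_trans (ler_norm_sum _ _ _) _.
apply: (@le_trans _ _ (B * \sum_j `|x j 0|)); last by rewrite ler_piMr.
by rewrite mulr_sumr; apply: ler_sum => j _; rewrite normrM ler_wpM2r.
Qed.

Lemma row_sum_le_opnorm (R : realType) (m n : nat) (A : 'M[R]_(m, n)) i :
  \sum_j `|A i j| <= opnorm +oo +oo A.
Proof.
(* Against the sign vector of row [i], the [i]th entry of the image is the absolute row sum. *)
have := lpnorm_mulmx_le A (\col_j Num.sg (A i j)) (ltry 0) (ltry 0).
have s1 : lpnorm +oo (\col_j Num.sg (A i j)) <= 1.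
  apply: bigmax_le => // j _; rewrite mxE normr_sg.
  by case: (_ != 0).
move=> /le_trans/(_ (ler_piMr (opnorm_ge0 _ (ltry 0) (ltry 0)) s1)); apply: le_trans.
apply: le_trans (entry_le_lpnorm _ i (ltry 0)); rewrite mxE.
apply: le_trans (ler_norm _); apply: ler_sum => j _.
by rewrite mxE mulrC -normrEsg.
Qed.

(** * Softmax: second-order expansion and Jacobian *)

(** From [1 - x <= expR (- x)] comes [expR x * (1 - x) <= 1]. As [1 - x] is at least 1/2,
    multiplying the upper bound by it leaves [x ^+ 2 <= 2 * x ^+ 2 * (1 - x)]. *)
Lemma expR_quadratic (R : realType) (x : R) : `|x| <= 2^-1 ->
  0 <= expR x - 1 - x <= 2 * x ^+ 2.
Proof.
rewrite ler_norml => /andP[x1 x2]; apply/andP; split.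
  by have := expR_ge1Dx x; lra.
have y0 : 0 < 1 - x by lra.
have h : expR x * (1 - x) <= 1.
  rewrite -[leRHS](expRxMexpNx_1 x) ler_wpM2l ?expR_ge0//; exact: expR_ge1Dx.
have e0 := expR_gt0 x.
rewrite -(ler_pM2r y0); nra.
Qed.

Lemma sum_expR_gt0 (R : realType) (n : nat) (b : 'cV[R]_n.+1) :
  0 < \sum_j expR (b j 0).
Proof.
by rewrite big_ord_recl ltr_wpDr ?expR_gt0//; apply: sumr_ge0 => j _; exact: expR_ge0.
Qed.

Lemma softmax_ge0 (R : realType) (n : nat) (b : 'cV[R]_n.+1) i :
  0 <= softmax b i 0.
Proof. by rewrite mxE divr_ge0 ?expR_ge0// ltW// sum_expR_gt0. Qed.

Lemma softmax_sum (R : realType) (n : nat) (b : 'cV[R]_n.+1) :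
  \sum_i softmax b i 0 = 1.
Proof.
under eq_bigr => i _ do rewrite mxE.
by rewrite -mulr_suml mulfV// gt_eqF// sum_expR_gt0.
Qed.

(** Exponential tilting: dividing by the old normalisation leaves a reweighting of [softmax b], so
    that only the small increments need expanding. *)
Lemma softmaxD (R : realType) (n : nat) (b e : 'cV[R]_n.+1) i :
  softmax (b + e) i 0 =
  softmax b i 0 * expR (e i 0) / \sum_j softmax b j 0 * expR (e j 0).
Proof.
have s0 := lt0r_neq0 (sum_expR_gt0 b).
rewrite !mxE expRD.
have -> : \sum_j softmax b j 0 * expR (e j 0) =
    (\sum_j expR ((b + e) j 0)) / \sum_j expR (b j 0).
  by rewrite mulr_suml; apply: eq_bigr => j _; rewrite !mxE expRD mulrAC.
have s1 := lt0r_neq0 (sum_expR_gt0 (b + e)).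
by field; rewrite s0 s1.
Qed.

(** The matrix [diag(S) - S S^T] with [S = softmax b], identified with the Jacobian once the
    expansion is available. *)
Definition softmax_diff (R : realType) (n : nat) (b : 'cV[R]_n) : 'M[R]_n :=
  \matrix_(i, j) (softmax b i 0 * ((i == j)%:R - softmax b j 0)).

Lemma softmax_diffE (R : realType) (n : nat) (b e : 'cV[R]_n) i :
  (softmax_diff b *m e) i 0 =
  softmax b i 0 * (e i 0 - \sum_j softmax b j 0 * e j 0).
Proof.
rewrite mxE mulrBr mulr_sumr.
transitivity (\sum_j (softmax b i 0 * (e j 0 *+ (i == j))
    - softmax b i 0 * (softmax b j 0 * e j 0))).
  by apply: eq_bigr => j _; rewrite mxE -mulr_natr; ring.
rewrite sumrB -mulr_sumr (bigD1 i)//= eqxx mulr1n big1 ?addr0// => j ji.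
by rewrite eq_sym (negbTE ji) mulr0n mulr0.
Qed.

(* With S = softmax b, e^{e_i} = 1 + e_i + r_i, m = sum S_j e_j and
   r = sum S_j r_j, the remainder is
   S_i (r_i - m (e_i - m) - r (1 + e_i - m)) / (1 + m + r). *)
Lemma softmax_expansion (R : realType) (n : nat) (b e : 'cV[R]_n.+1) (t : R) i :
  t <= 2^-1 -> (forall j, `|e j 0| <= t) ->
  `|softmax (b + e) i 0 - softmax b i 0 - (softmax_diff b *m e) i 0|
    <= 16 * t ^+ 2 * softmax b i 0.
Proof.
move=> t1 et; have t0 : 0 <= t := le_trans (normr_ge0 _) (et i).
pose S j := softmax b j 0; pose r j := expR (e j 0) - 1 - e j 0.
have S0 j : 0 <= S j by exact: softmax_ge0.
have et2 j : e j 0 ^+ 2 <= t ^+ 2.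
  by rewrite -real_normK ?num_real// lerXn2r ?nnegrE.
have r0 j : 0 <= r j by case/andP: (expR_quadratic (le_trans (et j) t1)).
have rt j : r j <= 2 * t ^+ 2.
  by case/andP: (expR_quadratic (le_trans (et j) t1)) => _ /le_trans; apply; rewrite ler_wpM2l.
pose m := \sum_j S j * e j 0; pose rr := \sum_j S j * r j.
have avg (f : 'I_n.+1 -> R) c : (forall j, f j <= c) -> \sum_j S j * f j <= c.
  move=> fc; rewrite -[leRHS]mul1r -(softmax_sum b) mulr_suml.
  by apply: ler_sum => j _; rewrite ler_wpM2l.
have et' j : - t <= e j 0 <= t by rewrite -ler_norml.
have mt : - t <= m <= t.
  apply/andP; split; last by apply: avg => j; case/andP: (et' j).
  rewrite lerNl -sumrN; under eq_bigr => j _ do rewrite -mulrN.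
  by apply: avg => j; rewrite lerNl; case/andP: (et' j).
have rrt : 0 <= rr <= 2 * t ^+ 2.
  by rewrite sumr_ge0 ?avg// => j _; rewrite mulr_ge0.
have D : \sum_j softmax b j 0 * expR (e j 0) = 1 + m + rr.
  rewrite -(softmax_sum b) -!big_split; apply: eq_bigr => j _ /=.
  by rewrite /r /S; ring.
rewrite softmaxD D softmax_diffE -/(S i) -/m.
have D2 : 2^-1 <= 1 + m + rr by lra.
have -> : expR (e i 0) = 1 + e i 0 + r i by rewrite /r; ring.
have -> : S i * (1 + e i 0 + r i) / (1 + m + rr) - S i - S i * (e i 0 - m) =
    S i * ((r i - m * (e i 0 - m) - rr * (1 + e i 0 - m)) / (1 + m + rr)).
  by field; rewrite gt_eqF//; lra.
rewrite normrM ger0_norm// mulrC ler_wpM2r//.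
rewrite normrM normfV [X in _ / X]ger0_norm; last lra.
rewrite ler_pdivrMr; last lra.
(* The three terms of the numerator are at most [2 t^2], [2 t^2] and [4 t^2] in absolute value, and
   the denominator is at least 1/2. *)
apply: (@le_trans _ _ (8 * t ^+ 2)); last by nra.
clear D D2; have := et' i; have := r0 i; have := rt i; move: mt rrt t0 t1.
move: (r i) (e i 0) m rr => ri ei m rr /andP[m1 m2] /andP[q1 q2] t0 t1 h1 h2 /andP[h3 h4].
have a1 : - (2 * t ^+ 2) <= m * (ei - m) <= 2 * t ^+ 2.
  by rewrite -ler_norml normrM (_ : 2 * t ^+ 2 = t * (2 * t)); [apply: ler_pM => //; rewrite ler_norml; lra | ring].
have a2 : 0 <= rr * (1 + ei - m) <= 2 * t ^+ 2 * 2.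
  by rewrite mulr_ge0 ?ler_pM//=; lra.
by rewrite ler_norml; lra.
Qed.

Lemma rV_norm_le (R : realType) (n : nat) (x : 'rV[R]_n) (B : R) :
  0 <= B -> (forall j, `|x 0 j| <= B) -> `|x| <= B.
Proof.
move=> B0 xB; rewrite /Num.norm /= mx_normrE; apply: bigmax_le => // -[i j] _ /=.
by rewrite ord1.
Qed.

Lemma entry_le_rV_norm (R : realType) (n : nat) (x : 'rV[R]_n) j :
  `|x 0 j| <= `|x|.
Proof.
rewrite [leRHS]/Num.norm /= mx_normrE.
exact: (le_bigmax _ (fun ij => `|x ij.1 ij.2|) (0, j)).
Qed.

(** Uniqueness of the differential asks for a continuous candidate. *)
Lemma mulmxr_continuous (R : realType) (m n : nat) (A : 'M[R]_(m, n)) :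
  continuous (mulmxr A : 'rV[R]_m -> 'rV[R]_n).
Proof.
apply: bounded_linear_continuous.
pose C := \sum_j \sum_i `|A i j|.
have C0 : 0 <= C by apply: sumr_ge0 => j _; apply: sumr_ge0.
exists C; split; first exact: num_real.
move=> B CB; near=> x.
apply: rV_norm_le => [|j]; first exact: ltW (le_lt_trans C0 CB).
rewrite /= mxE; apply: le_trans (ler_norm_sum _ _ _) _.
apply: le_trans (ltW CB); rewrite /C (bigD1 j)//= -[leLHS]addr0 lerD//; last first.
  by apply: sumr_ge0 => k _; apply: sumr_ge0.
apply: ler_sum => i _; rewrite normrM ler_piMl//.
apply: le_trans (entry_le_rV_norm _ _) _.
by near: x; exact: (@nbhs0_le R ('rV[R]_m : normedModType R)).
Unshelve. all: by end_near. Qed.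

(** The remainder in [softmax_expansion] is quadratic, hence [o(h)], and a continuous linear map
    with such a remainder is the differential. *)
Lemma softmax_jacobianE (R : realType) (n : nat) (b : 'cV[R]_n.+1) :
  softmax_jacobian b = softmax_diff b.
Proof.
pose V := 'rV[R]_n.+1 : normedModType R.
pose f : V -> V := fun v => (softmax v^T)^T.
pose df : {linear V -> V} := mulmxr (softmax_diff b)^T.
suff dfE : 'd f (b^T) = df :> (V -> V).
  rewrite /softmax_jacobian /jacobian -/f; apply: trmx_inj; rewrite trmxK.
  by apply/row_matrixP => i; rewrite !rowE mul_rV_lin1 dfE.
apply: diff_unique; first exact: mulmxr_continuous.
apply/eqaddoP => eps eps0; near=> h.
have h1 : `|h| <= 2^-1 by near: h; exact: (@nbhs0_le R V).
(* Chosen so that [16 |h|^2 <= eps |h|]. *)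
have h2 : `|h| <= eps / 16 by near: h; apply: (@nbhs0_le R V); rewrite divr_gt0.
rewrite opprD addrA.
apply: rV_norm_le => [|i]; first by rewrite mulr_ge0// ltW.
have hE : (h + b^T)^T = b + h^T by rewrite linearD /= trmxK addrC.
have dE : (h *m (softmax_diff b)^T) 0 i = (softmax_diff b *m h^T) i 0.
  by rewrite -[h in LHS]trmxK -trmx_mul mxE.
rewrite [X in `|X|](_ : _ =
    softmax (b + h^T) i 0 - softmax b i 0 - (softmax_diff b *m h^T) i 0); last first.
  by rewrite -dE -hE !fctE /f !mxE trmxK.
have hh j : `|h^T j 0| <= `|h| by rewrite mxE entry_le_rV_norm.
apply: le_trans (softmax_expansion b i h1 hh) _.
have s1 : softmax b i 0 <= 1.
  rewrite -(softmax_sum b) (bigD1 i)//= lerDl.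
  by apply: sumr_ge0 => j _; exact: softmax_ge0.
apply: le_trans (ler_piMr _ s1) _; first by rewrite mulr_ge0// exprn_ge0.
rewrite expr2 mulrA ler_wpM2r// mulrC -ler_pdivlMr//.
Unshelve. all: by end_near. Qed.

(** The linear term costs at most the operator norm times [t]. The quadratic remainders carry the
    weights [softmax b i 0], so they add up to [16 * t ^+ 2] whatever the length. *)
Lemma softmax_perturbation (R : realType) (n : nat) (b b' : 'cV[R]_n.+1) (t : R) :
  t <= 2^-1 -> (forall i, `|b' i 0 - b i 0| <= t) ->
  \sum_i `|softmax b' i 0 - softmax b i 0|
    <= opnorm +oo 1%:E (softmax_jacobian b) * t + 16 * t ^+ 2.
Proof.
move=> t1 bt; have t0 : 0 <= t := le_trans (normr_ge0 _) (bt 0).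
pose e := b' - b; have et j : `|e j 0| <= t by rewrite !mxE.
have -> : b' = b + e by rewrite /e addrCA subrr addr0.
apply: (@le_trans _ _ (\sum_i (`|(softmax_diff b *m e) i 0|
    + 16 * t ^+ 2 * softmax b i 0))).
  apply: ler_sum => i _.
  by rewrite -[X in `|X|](subrKC ((softmax_diff b *m e) i 0)) (le_trans (ler_normD _ _))// lerD2l softmax_expansion.
rewrite big_split /= -mulr_sumr softmax_sum mulr1 lerD2r.
rewrite -lpnorm1E -softmax_jacobianE.
apply: le_trans (lpnorm_mulmx_le _ _ (ltry 0) (@lte01 R)) _.
by rewrite ler_wpM2l ?opnorm_ge0//; exact: bigmax_le.
Qed.

(** * Spectral bound for the RoPE matrices *)

(** Lagrange's identity: twice the gap is a double sum of weighted squares. *)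
Lemma weighted_cauchy_schwarz (R : realType) (I : finType) (w x y : I -> R) :
  (forall i, 0 <= w i) ->
  (\sum_i w i * (x i * y i)) ^+ 2 <=
    (\sum_i w i * x i ^+ 2) * (\sum_i w i * y i ^+ 2).
Proof.
move=> w0; rewrite -subr_ge0 -(pmulr_rge0 _ (ltr0Sn R 1)).
have -> : 2 * ((\sum_i w i * x i ^+ 2) * (\sum_i w i * y i ^+ 2)
      - (\sum_i w i * (x i * y i)) ^+ 2) =
    \sum_i \sum_j w i * w j * (x i * y j - x j * y i) ^+ 2.
  set A := \sum_i w i * x i ^+ 2; set C := \sum_i w i * y i ^+ 2.
  set B := \sum_i w i * (x i * y i).
  transitivity (A * C + C * A - 2 * (B * B)); first by ring.
  rewrite !big_distrlr /= mulr_sumr -big_split -sumrB /=.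
  apply: eq_bigr => i _; rewrite mulr_sumr -big_split -sumrB /=.
  by apply: eq_bigr => j _; ring.
by apply: sumr_ge0 => i _; apply: sumr_ge0 => j _; exact: mulr_ge0 (mulr_ge0 _ _) (sqr_ge0 _).
Qed.

(* Schur's test: Cauchy-Schwarz in each row with weights [B i j]. *)
Lemma sqr_norm_mulmx_le (R : realType) (n : nat) (r : R) (B : 'M[R]_n)
    (u : 'cV[R]_n) : 0 <= r -> (forall i j, 0 <= B i j) ->
  (forall i, \sum_j B i j <= r) -> (forall j, \sum_i B i j <= r) ->
  \sum_i (B *m u) i 0 ^+ 2 <= r ^+ 2 * \sum_i u i 0 ^+ 2.
Proof.
move=> r0 B0 row_r col_r.
apply: (@le_trans _ _ (\sum_i r * \sum_j B i j * u j 0 ^+ 2)).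
  apply: ler_sum => i _; rewrite mxE.
  have := weighted_cauchy_schwarz (fun=> 1) (fun j => u j 0) (B0 i).
  under eq_bigr => j _ do rewrite mul1r.
  under [X in _ <= X * _ -> _]eq_bigr => j _ do rewrite expr1n mulr1.
  move=> /le_trans; apply; rewrite ler_wpM2r//.
  by apply: sumr_ge0 => j _; rewrite mulr_ge0// sqr_ge0.
rewrite -mulr_sumr exchange_big /= expr2 -mulrA ler_wpM2l// mulr_sumr.
by apply: ler_sum => j _; rewrite -mulr_suml ler_wpM2r// sqr_ge0.
Qed.

Lemma cos_sin_norm_le (R : realType) (x : R) :
  `|cos x| + `|sin x| <= Num.sqrt 2.
Proof.
rewrite -[leLHS]ger0_norm ?addr_ge0// -sqrtr_sqr ler_sqrt//.
have := cos2Dsin2 x; rewrite -(real_normK (num_real (cos x))) -(real_normK (num_real (sin x))).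
have := sqr_ge0 (`|cos x| - `|sin x|); nra.
Qed.

(** Transposition only flips the sign of the sines, so a row-sum bound also serves as the column-sum
    bound of Schur's test. *)
Lemma rope_norm_sym (R : realType) (tau dhead n : nat) i j :
  `|rope R tau dhead n i j| = `|rope R tau dhead n j i|.
Proof.
rewrite !mxE (eq_sym j./2); case: eqP => //= ->; rewrite (eq_sym (odd j)).
by case: (odd i); case: (odd j) => //=; rewrite normrN.
Qed.

Lemma rope_row_sum (R : realType) (tau dhead n : nat) i :
  \sum_j `|rope R tau dhead n i j| <= Num.sqrt 2.
Proof.
pose theta : R := n%:R * rope_freq R tau dhead i./2.
(* [P] marks the other index of the block of [i], where the sine stands. Half and parity determine
   an index, so it holds at most once. *)
pose P (j : 'I_dhead) := (i./2 == j./2) && (odd i != odd j).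
have P1 : \sum_j (P j)%:R <= 1 :> R.
  have [j0 Pj0|P0] := pickP P; last by rewrite big1// => j _; rewrite P0.
  rewrite (bigD1 j0)//= Pj0 big1 ?addr0// => j jj0.
  suff -> : P j = false by [].
  apply: contraNF jj0 => /andP[/eqP h1 h2]; case/andP: Pj0 => /eqP h3 h4.
  apply/eqP/val_inj => /=; rewrite -(odd_double_half j) -(odd_double_half j0) -h1 -h3.
  by move: h2 h4; case: (odd i); case: (odd j); case: (odd j0).
apply: (le_trans _ (cos_sin_norm_le theta)).
apply: (@le_trans _ _ (\sum_j (`|cos theta| * (i == j)%:R + `|sin theta| * (P j)%:R))).
  apply: ler_sum => j _; rewrite mxE /P -/theta.
  have [hij|] /= := eqVneq i./2 j./2; last by rewrite normr0 addr_ge0// mulr_ge0.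
  have [oij|] /= := eqVneq (odd i) (odd j).
    have -> : i == j.
      by apply/eqP/val_inj; rewrite /= -(odd_double_half i) -(odd_double_half j) hij oij.
    by rewrite mulr1 mulr0 addr0.
  move=> _; have -> : `|if odd i then sin theta else - sin theta| = `|sin theta|.
    by case: ifP => // _; rewrite normrN.
  by rewrite mulr1 lerDr mulr_ge0.
rewrite big_split -!mulr_sumr lerD// ler_piMr//.
rewrite (bigD1 i)//= eqxx big1 ?addr0// => j ji.
by rewrite eq_sym (negbTE ji).
Qed.

(** Cauchy-Schwarz after Schur's test: each [|R|] multiplies the l_2 norm by at most [sqrt 2], and
    the two factors give 2. *)
Lemma rope_bilinear_le (R : realType) (tau dhead t n : nat) (u v : 'cV[R]_dhead) :
  \sum_i (mxabs (rope R tau dhead t) *m u) i 0 * (mxabs (rope R tau dhead n) *m v) i 0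
    <= 2 * (lpnorm 2%:E u * lpnorm 2%:E v).
Proof.
have sq k (z : 'cV[R]_dhead) :
    \sum_i (mxabs (rope R tau dhead k) *m z) i 0 ^+ 2 <= 2 * lpnorm 2%:E z ^+ 2.
  rewrite sqr_lpnorm2 -[X in X * _](@sqr_sqrtr _ 2)//.
  apply: sqr_norm_mulmx_le; first exact: sqrtr_ge0.
  - by move=> i j; rewrite mxE.
  - by move=> i; under eq_bigr do rewrite mxE; exact: rope_row_sum.
  - by move=> j; under eq_bigr do rewrite mxE rope_norm_sym; exact: rope_row_sum.
apply: le_trans (ler_norm _) _; rewrite -[leRHS]ger0_norm; last first.
  by rewrite !mulr_ge0// lpnorm_ge0.
rewrite -ler_sqr ?nnegrE// !real_normK ?num_real//.
have := @weighted_cauchy_schwarz R _ (fun=> 1)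
  (fun i => (mxabs (rope R tau dhead t) *m u) i 0)
  (fun i => (mxabs (rope R tau dhead n) *m v) i 0) (fun=> ler01).
under eq_bigr => i _ do rewrite mul1r.
under [X in _ <= X * _ -> _]eq_bigr => i _ do rewrite mul1r.
under [X in _ <= _ * X -> _]eq_bigr => i _ do rewrite mul1r.
move=> /le_trans; apply.
rewrite [leRHS](_ : _ = (2 * lpnorm 2%:E u ^+ 2) * (2 * lpnorm 2%:E v ^+ 2)); last by ring.
by apply: ler_pM => //; apply: sumr_ge0 => i _; exact: sqr_ge0.
Qed.

(** * Perturbations relative to an entrywise majorant *)

(* Errors are measured relative to [U] and not to [|A|], which would not be
   stable under products because of cancellation. *)
Definition perturb (R : realType) (m n : nat) (e : R) (U A A' : 'M[R]_(m, n)) : Prop :=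
  forall i j, `|A i j| <= U i j /\ `|A' i j - A i j| <= e * U i j.

Lemma perturb_refl (R : realType) (m n : nat) (A : 'M[R]_(m, n)) :
  perturb 0 (mxabs A) A A.
Proof. by move=> i j; rewrite mxE subrr normr0 mul0r. Qed.

Lemma perturb_le (R : realType) (m n : nat) (e e' : R) (U U' A A' : 'M[R]_(m, n)) :
  0 <= e -> e <= e' -> (forall i j, U i j <= U' i j) ->
  perturb e U A A' -> perturb e' U' A A'.
Proof.
move=> e0 ee' UU' h i j; have [h1 h2] := h i j.
split; first exact: le_trans (UU' i j).
apply: (le_trans h2); apply: ler_pM => //; exact: le_trans (normr_ge0 _) h1.
Qed.

Lemma perturb_norm (R : realType) (m n : nat) (e : R) (U A A' : 'M[R]_(m, n)) i j :
  perturb e U A A' -> `|A' i j| <= (1 + e) * U i j.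
Proof.
move=> /(_ i j)[h1 h2]; rewrite -[X in `|X|](subrKC (A i j)) mulrDl mul1r.
by rewrite (le_trans (ler_normD _ _))// lerD.
Qed.

(** The rounding error is relative to [|A'| |B'|], at most [(1 + a) (1 + b) U V]. The inherited
    error telescopes as [(A' - A) B' + A (B' - B)], which gives [a (1 + b) + b]. *)
Lemma perturb_mulmx (R : realType) (m k n : nat) (a b c : R)
    (U A A' : 'M[R]_(m, k)) (V B B' : 'M[R]_(k, n)) (C : 'M[R]_(m, n)) :
  0 <= a -> 0 <= b -> 0 <= c -> perturb a U A A' -> perturb b V B B' ->
  product_within c A' B' C ->
  perturb ((1 + a) * (1 + b) * (1 + c) - 1) (U *m V) (A *m B) C.
Proof.
move=> a0 b0 c0 hA hB hC i j.
have U0 l : 0 <= U i l by have [h _] := hA i l; exact: le_trans (normr_ge0 _) h.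
have V0 l : 0 <= V l j by have [h _] := hB l j; exact: le_trans (normr_ge0 _) h.
split.
  rewrite !mxE; apply: le_trans (ler_norm_sum _ _ _) _; apply: ler_sum => l _.
  by rewrite normrM ler_pM//; [case: (hA i l) | case: (hB l j)].
rewrite -[X in `|X|](subrKA ((A' *m B') i j)).
apply: (@le_trans _ _ (c * ((1 + a) * (1 + b) * (U *m V) i j)
    + ((1 + a) * (1 + b) - 1) * (U *m V) i j)); last first.
  by rewrite le_eqVlt; apply/orP; left; apply/eqP; ring.
apply: le_trans (ler_normD _ _) (lerD _ _).
  apply: le_trans (hC i j) _; rewrite ler_wpM2l// !mxE mulr_sumr.
  apply: ler_sum => l _; rewrite !mxE mulrACA.
  by rewrite ler_pM//; apply: perturb_norm; eassumption.
rewrite !mxE -sumrB mulr_sumr; apply: le_trans (ler_norm_sum _ _ _) _.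
apply: ler_sum => l _.
have -> : A' i l * B' l j - A i l * B l j =
    (A' i l - A i l) * B' l j + A i l * (B' l j - B l j) by ring.
apply: le_trans (ler_normD _ _) _; rewrite !normrM.
have [hA1 hA2] := hA i l; have [hB1 hB2] := hB l j.
have hB3 := perturb_norm l j hB.
apply: (@le_trans _ _ (a * U i l * ((1 + b) * V l j) + U i l * (b * V l j))).
  by rewrite lerD// ler_pM.
by rewrite le_eqVlt; apply/orP; left; apply/eqP; ring.
Qed.

Lemma perturb_mulmx_exact (R : realType) (m k n : nat) (b c : R)
    (A : 'M[R]_(m, k)) (V B B' : 'M[R]_(k, n)) (C : 'M[R]_(m, n)) :
  0 <= b -> 0 <= c -> perturb b V B B' -> product_within c A B' C ->
  perturb ((1 + b) * (1 + c) - 1) (mxabs A *m V) (A *m B) C.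
Proof.
move=> b0 c0 hB hC.
by have := perturb_mulmx (lexx 0) b0 c0 (perturb_refl A) hB hC; rewrite addr0 mul1r.
Qed.

(* The weights are perturbed in l_1 only: the effect of the score errors on
   softmax is not controlled by [kappa] entrywise. *)
Lemma perturb_average (R : realType) (m k : nat) (a q c mu : R)
    (A A' : 'M[R]_(m, k)) (p p' : 'cV[R]_k) (C : 'cV[R]_m) :
  0 <= a -> 0 <= c -> 0 <= mu -> perturb a (const_mx mu) A A' ->
  \sum_i `|p i 0| <= 1 -> \sum_i `|p' i 0 - p i 0| <= q ->
  product_within c A' p' C ->
  perturb ((1 + a) * (1 + q) * (1 + c) - 1) (const_mx mu) (A *m p) C.
Proof.
move=> a0 c0 mu0 hA p1 pq hC i j; rewrite ord1 {j}.
have -> : (const_mx mu : 'cV[R]_m) i 0 = mu by rewrite mxE.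
have hA1 l : `|A i l| <= mu by have [] := hA i l; rewrite mxE.
have hA2 l : `|A' i l - A i l| <= a * mu by have [_] := hA i l; rewrite mxE.
have hA3 l : `|A' i l| <= (1 + a) * mu by have := perturb_norm i l hA; rewrite mxE.
split.
  rewrite mxE; apply: le_trans (ler_norm_sum _ _ _) _.
  apply: (@le_trans _ _ (mu * \sum_l `|p l 0|)); last by rewrite ler_piMr.
  by rewrite mulr_sumr; apply: ler_sum => l _; rewrite normrM ler_wpM2r.
have p'q : \sum_l `|p' l 0| <= 1 + q.
  apply: (@le_trans _ _ (\sum_l (`|p l 0| + `|p' l 0 - p l 0|))).
    by apply: ler_sum => l _; rewrite -[X in `|X| <= _](subrKC (p l 0)) ler_normD.
  by rewrite big_split lerD.
rewrite -[X in `|X|](subrKA ((A' *m p') i 0)).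
apply: (@le_trans _ _ (c * ((1 + a) * mu * (1 + q))
    + ((1 + a) * mu * q + a * mu * 1))); last first.
  by rewrite le_eqVlt; apply/orP; left; apply/eqP; ring.
have amu : 0 <= (1 + a) * mu by rewrite mulr_ge0// addr_ge0.
apply: le_trans (ler_normD _ _) (lerD _ _).
  apply: le_trans (hC i 0) _; rewrite ler_wpM2l// mxE.
  apply: le_trans (ler_wpM2l amu p'q).
  by rewrite mulr_sumr; apply: ler_sum => l _; rewrite !mxE ler_wpM2r.
rewrite !mxE -sumrB; apply: le_trans (ler_norm_sum _ _ _) _.
apply: (@le_trans _ _ (\sum_l ((1 + a) * mu * `|p' l 0 - p l 0| + a * mu * `|p l 0|))).
  apply: ler_sum => l _.
  (* This splitting pairs the error of the matrix with the exact weights, whose l_1 norm is at most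
     1, and the error of the weights with [A']. *)
  have -> : A' i l * p' l 0 - A i l * p l 0 =
      A' i l * (p' l 0 - p l 0) + (A' i l - A i l) * p l 0 by ring.
  by rewrite (le_trans (ler_normD _ _))// !normrM lerD// ler_wpM2r.
by rewrite big_split -!mulr_sumr /= lerD// ler_wpM2l// mulr_ge0.
Qed.

Lemma product_within_le (R : realType) (m k n : nat) (c c' : R)
    (A : 'M[R]_(m, k)) (B : 'M[R]_(k, n)) (C : 'M[R]_(m, n)) :
  c <= c' -> product_within c A B C -> product_within c' A B C.
Proof.
move=> cc' h i j; apply: le_trans (h i j) _; rewrite ler_wpM2r// mxE.
by apply: sumr_ge0 => l _; rewrite !mxE mulr_ge0.
Qed.

Lemma perturb_rope_cols (R : realType) (tau dhead N : nat) (e c : R)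
    (U Y Y' Z : 'M[R]_(dhead, N)) :
  0 <= e -> 0 <= c -> perturb e U Y Y' ->
  (forall n : 'I_N, product_within c (rope R tau dhead n.+1) (col n Y') (col n Z)) ->
  perturb ((1 + e) * (1 + c) - 1)
    (\matrix_(i, n) (mxabs (rope R tau dhead n.+1) *m col n U) i 0)
    (rope_cols tau Y) Z.
Proof.
move=> e0 c0 hY hZ i n.
have hc : perturb e (col n U) (col n Y) (col n Y') by move=> k l; rewrite !mxE; exact: hY.
have := perturb_mulmx_exact e0 c0 hc (hZ n) i 0.
by rewrite [col n Z i 0]mxE [rope_cols _ _ _ _]mxE [(\matrix_(_, _) _) i n]mxE.
Qed.

(** * Errors of the scores, of a head and of attention *)

(** Queries and keys each pass through a projection ([ed]) and a rotation ([er]), whence the square;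
    [eh] comes from the inner product and [ua] from the scaling. *)
Lemma scores_error (R : realType) (tau dhead d N : nat)
    (WQh WKh : 'M[R]_(dhead, d)) (X : 'M[R]_(d, N)) (ed er eh ua x : R)
    (Q K RQ RK : 'M[R]_(dhead, N)) (n : 'I_N) (s b : 'cV[R]_n.+1) :
  0 <= ed -> 0 <= er -> 0 <= eh -> 0 <= ua -> 0 <= x -> (forall i j, `|X i j| <= x) ->
  product_within ed WQh X Q -> product_within ed WKh X K ->
  (forall n : 'I_N, product_within er (rope R tau dhead n.+1) (col n Q) (col n RQ)) ->
  (forall n : 'I_N, product_within er (rope R tau dhead n.+1) (col n K) (col n RK)) ->
  product_within eh (causal n RK)^T (col n RQ) s ->
  fl_scale ua (Num.sqrt dhead%:R)^-1 s b ->
  forall t, `|b t 0 - scores tau WQh WKh X n t 0| <=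
    ((1 + ua) * ((1 + eh) * ((1 + ed) * (1 + er)) ^+ 2) - 1)
    * (2 * (Num.sqrt dhead%:R)^-1 * opnorm +oo 2%:E (mxabs WKh)
       * opnorm +oo 2%:E (mxabs WQh) * x ^+ 2).
Proof.
move=> ed0 er0 eh0 ua0 x0 Xx hQ hK hRQ hRK hs hb t.
set c := _^-1; have c0 : 0 <= c by rewrite invr_ge0 sqrtr_ge0.
pose bnd (W : 'M[R]_(dhead, d)) : 'M[R]_(dhead, N) :=
  \matrix_(i, n) (mxabs (rope R tau dhead n.+1) *m col n (mxabs W *m mxabs X)) i 0.
pose ee := (1 + ed) * (1 + er) - 1.
have ee0 : 0 <= ee by rewrite subr_ge0 mulr_ege1// lerDl.
have aX : perturb 0 (mxabs X) X X by exact: perturb_refl.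
have step W Y Z : product_within ed W X Y ->
    (forall n : 'I_N, product_within er (rope R tau dhead n.+1) (col n Y) (col n Z)) ->
    perturb ee (bnd W) (rope_cols tau (W *m X)) Z.
  move=> hY hZ; apply: perturb_rope_cols hZ => //.
  by have := perturb_mulmx_exact (lexx 0) ed0 aX hY; rewrite addr0 mul1r addrAC subrr add0r.
have aK : perturb ee (causal n (bnd WKh))^T (causal n (rope_cols tau (WKh *m X)))^T
    (causal n RK)^T.
  by move=> i j; rewrite !mxE; have := step _ _ _ hK hRK j (widen_ord (ltn_ord n) i); rewrite !mxE.
have aQ : perturb ee (col n (bnd WQh)) (col n (rope_cols tau (WQh *m X))) (col n RQ).
  by move=> i j; have := step _ _ _ hQ hRQ i n; rewrite !mxE.
have as_ := perturb_mulmx ee0 ee0 eh0 aK aQ hs t 0.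
pose UV := ((causal n (bnd WKh))^T *m col n (bnd WQh)) t 0; rewrite -/UV in as_.
(* By [rope_bilinear_le]: since [|x_n|] has sup norm at most [x], the l_2 norm of [|W| |x_n|] is at
   most [opnorm +oo 2%:E (mxabs W) * x]. *)
have UV_le : UV <= 2 * (opnorm +oo 2%:E (mxabs WKh) * x) * (opnorm +oo 2%:E (mxabs WQh) * x).
  have nrm (W : 'M[R]_(dhead, d)) k : lpnorm 2%:E (col k (mxabs W *m mxabs X)) <= opnorm +oo 2%:E (mxabs W) * x.
    have two0 : (0 < 2%:E :> \bar R)%E by rewrite lte_fin.
    rewrite colE -mulmxA -colE; apply: le_trans (lpnorm_mulmx_le _ _ (ltry 0) two0) _.
    rewrite ler_wpM2l ?opnorm_ge0//; apply: bigmax_le => // i _.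
    by rewrite !mxE normr_id.
  have -> : UV = \sum_i (mxabs (rope R tau dhead (widen_ord (ltn_ord n) t).+1)
        *m col (widen_ord (ltn_ord n) t) (mxabs WKh *m mxabs X)) i 0
      * (mxabs (rope R tau dhead n.+1) *m col n (mxabs WQh *m mxabs X)) i 0.
    by rewrite /UV mxE; apply: eq_bigr => i _; congr (_ * _); rewrite ![LHS]mxE [RHS]mxE.
  apply: le_trans (rope_bilinear_le _ _ _ _ _) _.
  by rewrite -mulrA ler_wpM2l// ler_pM// lpnorm_ge0.
have [s1 s2] := as_; have UV0 : 0 <= UV := le_trans (normr_ge0 _) s1.
rewrite [scores _ _ _ _ _ _ _]mxE -/c; move: s1 s2.
set st := (_ *m _) t 0 => s1 s2.
set E := _ - 1 in s2.
have E0 : 0 <= E by rewrite subr_ge0 !mulr_ege1// lerDl.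
have s3 : `|s t 0| <= (1 + E) * UV.
  by rewrite -[X in `|X|](subrKC st) mulrDl mul1r (le_trans (ler_normD _ _))// lerD.
apply: (@le_trans _ _ (((1 + ua) * (1 + E) - 1) * (c * UV))).
  rewrite -[X in `|X|](subrKA (c * s t 0)).
  rewrite [leRHS](_ : _ = ua * (c * ((1 + E) * UV)) + c * (E * UV)); last by ring.
  apply: le_trans (ler_normD _ _) (lerD _ _).
    apply: le_trans (hb t) _; rewrite ler_wpM2l// normrM ger0_norm//.
    by rewrite ler_wpM2l.
  by rewrite -mulrBr normrM ger0_norm// ler_wpM2l.
have -> : (1 + eh) * ((1 + ed) * (1 + er)) ^+ 2 = 1 + E.
  by rewrite /E /ee; ring.
apply: ler_wpM2l; first by rewrite subr_ge0 mulr_ege1// lerDl.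
apply: le_trans (ler_wpM2l c0 UV_le) _.
move: (opnorm _ _ _) (opnorm _ _ _) => NK NQ; clearbody c.
by rewrite le_eqVlt; apply/orP; left; apply/eqP; ring.
Qed.

(** The values are entrywise at most [mu * x] and the exact weights form a probability vector, so
    the output obeys the same bound and [perturb_average] compounds the errors. *)
Lemma head_error (R : realType) (tau dhead d N : nat)
    (WQh WKh WVh : 'M[R]_(dhead, d)) (X : 'M[R]_(d, N)) (ed en es x mu kappa delta : R)
    (V : 'M[R]_(dhead, N)) (n : 'I_N) (b p : 'cV[R]_n.+1) (a : 'cV[R]_dhead) :
  0 <= ed -> 0 <= en -> 0 <= x -> (forall i j, `|X i j| <= x) ->
  opnorm +oo +oo WVh <= mu ->
  opnorm +oo 1%:E (softmax_jacobian (scores tau WQh WKh X n)) <= kappa ->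
  delta <= 2^-1 -> (forall t, `|b t 0 - scores tau WQh WKh X n t 0| <= delta) ->
  product_within ed WVh X V ->
  (forall t, `|p t 0 - softmax b t 0| <= es * softmax b t 0) ->
  product_within en (causal n V) p a ->
  perturb ((1 + ed) * (1 + (es + (kappa * delta + 16 * delta ^+ 2))) * (1 + en) - 1)
    (const_mx (mu * x)) (head_output tau WQh WKh WVh X n) a.
Proof.
move=> ed0 en0 x0 Xx hmu hkappa delta1 hb hV hp ha.
have delta0 : 0 <= delta := le_trans (normr_ge0 _) (hb 0).
have mu0 : 0 <= mu := le_trans (opnorm_ge0 _ (ltry 0) (ltry 0)) hmu.
have aV : perturb ed (const_mx (mu * x)) (WVh *m X) V.
  have aX : perturb 0 (mxabs X) X X by exact: perturb_refl.
  have := perturb_mulmx_exact (lexx 0) ed0 aX hV.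
  rewrite addr0 mul1r addrAC subrr add0r; apply: perturb_le => // i j.
  rewrite !mxE; apply: (@le_trans _ _ (opnorm +oo +oo WVh * x)); last by rewrite ler_wpM2r.
  apply: le_trans (ler_wpM2r x0 (row_sum_le_opnorm _ i)).
  by rewrite mulr_suml; apply: ler_sum => k _; rewrite !mxE ler_wpM2l.
have aVn : perturb ed (const_mx (mu * x)) (causal n (WVh *m X)) (causal n V).
  by move=> i j; have := aV i (widen_ord (ltn_ord n) j); rewrite !mxE.
apply: (perturb_average ed0 en0 _ aVn _ _ ha); first by rewrite mulr_ge0.
  under eq_bigr => i _ do rewrite ger0_norm ?softmax_ge0//.
  by rewrite softmax_sum.
(* Rounding in softmax is relative to the softmax of the computed scores [b], of sum 1, and gives
   [es]; passing to the exact scores costs [softmax_perturbation]. *)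
apply: (@le_trans _ _ (\sum_i (es * softmax b i 0
    + `|softmax b i 0 - softmax (scores tau WQh WKh X n) i 0|))).
  apply: ler_sum => i _; rewrite -[X in `|X|](subrKA (softmax b i 0)).
  by rewrite (le_trans (ler_normD _ _))// lerD2r.
rewrite big_split -mulr_sumr softmax_sum mulr1 lerD2l.
apply: le_trans (softmax_perturbation delta1 hb) _.
by rewrite lerD2r ler_wpM2r.
Qed.

Lemma attention_error (R : realType) (tau nhead dhead N : nat)
    (WQ WK WV WO : 'M[R]_(nhead * dhead)) (X Y : 'M[R]_(nhead * dhead, N))
    (a : 'I_nhead -> 'I_N -> 'cV[R]_dhead) (e ed mu : R) :
  0 <= e -> 0 <= ed -> 0 <= mu ->
  (forall h n, perturb e (const_mx mu)
    (head_output tau (row_block WQ h) (row_block WK h) (row_block WV h) X n) (a h n)) ->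
  product_within ed WO (stack_heads a) Y ->
  opnorm 1%:E +oo (Y - attention tau WQ WK WV WO X)
    <= ((1 + e) * (1 + ed) - 1) * opnorm +oo +oo WO * mu.
Proof.
move=> e0 ed0 mu0 ha hY.
have c0 : 0 <= (1 + e) * (1 + ed) - 1 by rewrite subr_ge0 mulr_ege1// lerDl.
have W0 := opnorm_ge0 WO (ltry 0) (ltry 0).
apply: opnorm_1oo_le => [|i j]; first by rewrite !mulr_ge0.
have as_ : perturb e (const_mx mu) (stack_heads (fun h n =>
    head_output tau (row_block WQ h) (row_block WK h) (row_block WV h) X n)) (stack_heads a).
  move=> k l; have := ha (Ordinal (block_head_subproof k)) l (Ordinal (block_pos_subproof k)) 0.
  by rewrite ![const_mx _ _ _]mxE [stack_heads _ _ _]mxE [stack_heads a _ _]mxE.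
have [_] := perturb_mulmx_exact e0 ed0 as_ hY i j.
have -> : (Y - attention tau WQ WK WV WO X) i j = Y i j - attention tau WQ WK WV WO X i j.
  by rewrite [LHS]mxE [X in _ + X]mxE.
move=> /le_trans; apply.
rewrite -mulrA ler_wpM2l// mxE.
apply: le_trans (ler_wpM2r mu0 (row_sum_le_opnorm WO i)).
by rewrite mulr_suml; apply: ler_sum => k _; rewrite !mxE.
Qed.

(** * First-order bookkeeping of error factors *)

(* f is the first-order part, as u -> 0, of the bound e. *)
Definition first_order (R : realType) (B u e f : R) : Prop :=
  [/\ 0 <= e, e <= f + B * u ^+ 2 & f <= B * u].

Lemma first_order_linear (R : realType) (B u e f : R) :
  0 <= B -> 0 <= u <= 1 -> first_order B u e f -> e <= 2 * B * u.
Proof.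
move=> B0 /andP[u0 u1] [_ h1 h2]; apply: (le_trans h1).
have : B * u ^+ 2 <= B * u by rewrite ler_wpM2l// expr2 ler_piMl.
lra.
Qed.

(** The cross term of [(1 + e1) (1 + e2) - 1] is at most [(2 B1 u) (2 B2 u)], hence the coefficient
    4. *)
Definition compound (R : realType) (B1 B2 : R) : R := B1 + B2 + 4 * B1 * B2.

Lemma compound_ge0 (R : realType) (B1 B2 : R) :
  0 <= B1 -> 0 <= B2 -> 0 <= compound B1 B2.
Proof. by move=> h1 h2; rewrite !addr_ge0// !mulr_ge0. Qed.

Lemma first_orderM (R : realType) (B1 B2 u e1 e2 f1 f2 : R) :
  0 <= B1 -> 0 <= B2 -> 0 <= u <= 1 ->
  first_order B1 u e1 f1 -> first_order B2 u e2 f2 ->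
  first_order (compound B1 B2) u ((1 + e1) * (1 + e2) - 1) (f1 + f2).
Proof.
move=> B10 B20 u01 h1 h2.
have l1 := first_order_linear B10 u01 h1; have l2 := first_order_linear B20 u01 h2.
case: h1 h2 => [p1 q1 r1] [p2 q2 r2]; case/andP: u01 => u0 u1.
have e12 : e1 * e2 <= (2 * B1 * u) * (2 * B2 * u) by rewrite ler_pM.
have e120 : 0 <= e1 * e2 by rewrite mulr_ge0.
have B12 : 0 <= B1 * B2 * u by rewrite !mulr_ge0.
split; rewrite /compound; lra.
Qed.

(** * Uniform bounds from the floating-point model *)

(** The model evaluates its constants at [uw] and [ua], which range over positive numbers up to
    [uq], so smallness of [uq] has to control all smaller round-offs. *)
Lemma near_right_le (R : realType) (P : R -> Prop) :
  (\forall u \near (0 : R)^'+, P u) ->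
  \forall u \near 0^'+, forall v, 0 < v -> v <= u -> P v.
Proof.
move=> [e /= e0 he]; exists e => //= u; rewrite /ball_ /= sub0r normrN => ue u0 v v0 vu.
apply: he => //=; rewrite sub0r normrN gtr0_norm//.
by apply: le_lt_trans vu _; rewrite gtr0_norm in ue.
Qed.

(** The thresholds may depend on the length; finitely many lengths have a common one. *)
Lemma near_right_forall_le (R : realType) (K : nat) (P : nat -> R -> Prop) :
  (forall k, \forall u \near 0^'+, P k u) ->
  \forall u \near 0^'+, forall k, (k <= K)%N -> P k u.
Proof.
move=> hP.
have : \forall u \near (0 : R)^'+, forall k : 'I_K.+1, P k u.
  by apply: filter_forall => k; exact: hP.
apply: filterS => u hu k; rewrite -ltnS => kK; exact: hu (Ordinal kK).
Qed.

Lemma bigO_forall_le (R : realType) (K : nat) (f : nat -> R -> R) (g : R -> R) :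
  (forall k, (f k : R -> R^o) =O_ (0^'+) (g : R -> R^o)) ->
  \forall B \near +oo, \forall u \near 0^'+,
    forall k, (k <= K)%N -> `|f k u| <= B * `|g u|.
Proof.
move=> hf.
have : \forall B \near +oo, forall k : 'I_K.+1,
    (\forall u \near 0^'+, `|f k u| <= B * `|g u|).
  apply: filter_forall => k.
  by have /eqOP := hf k.
apply: filterS => B hB.
have : \forall u \near (0 : R)^'+, forall k : 'I_K.+1, `|f k u| <= B * `|g u|.
  exact: filter_forall.
apply: filterS => u hu k; rewrite -ltnS => kK; exact: hu (Ordinal kK).
Qed.

(** The asymptotic hypotheses become plain inequalities, with one [B] for all lengths up to [K] and
    all smaller round-offs. *)
Lemma model_bounds (R : realType) (K : nat) (gammaMM : nat -> R -> R)
    (rho_rope : R -> R) (rho_softmax : nat -> R -> R) :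
  summation_constant gammaMM -> second_order rho_rope ->
  (forall n, second_order (rho_softmax n)) ->
  exists2 B : R, 0 < B & \forall uq \near 0^'+, forall u, 0 < u -> u <= uq ->
    [/\ forall k, (k <= K)%N -> 0 <= gammaMM k u <= B * u,
        forall k l, (k <= l)%N -> (l <= K)%N -> gammaMM k u <= gammaMM l u,
        rho_rope u <= B * u ^+ 2
      & forall k, (k <= K)%N -> rho_softmax k u <= B * u ^+ 2].
Proof.
move=> [g0 gle gO] hrope hsoft.
near (pinfty_nbhs R) => B.
have hg : \forall u \near 0^'+, forall k, (k <= K)%N -> `|gammaMM k u| <= B * `|u|.
  by near: B; exact: bigO_forall_le gO.
have hs : \forall u \near 0^'+, forall k, (k <= K)%N -> `|rho_softmax k u| <= B * `|u ^+ 2|.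
  by near: B; exact: bigO_forall_le hsoft.
(* A constant family over [k <= 0] brings [rho_rope] under the same lemma. *)
have hr : \forall u \near 0^'+, forall k, (k <= 0)%N -> `|rho_rope u| <= B * `|u ^+ 2|.
  by near: B; exact: (bigO_forall_le 0 (fun=> hrope)).
exists B; first by near: B; exact: nbhs_pinfty_gt.
apply: near_right_le.
have h0 := near_right_forall_le K g0.
have hle : \forall u \near (0:R)^'+, forall l, (l <= K)%N -> forall k, (k <= K)%N ->
    (k <= l)%N -> gammaMM k u <= gammaMM l u.
  apply: near_right_forall_le => l; apply: near_right_forall_le => k.
  by case: (leqP k l) => [/gle|]; [apply: filterS | move=> _; exact: nearW].
near=> u.
have u0 : 0 < u by near: u; exact: nbhs_right_gt.
have hgu : forall k, (k <= K)%N -> `|gammaMM k u| <= B * `|u| by near: u.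
have h0u : forall k, (k <= K)%N -> 0 <= gammaMM k u by near: u.
have hru : forall k, (k <= 0)%N -> `|rho_rope u| <= B * `|u ^+ 2| by near: u.
have hsu : forall k, (k <= K)%N -> `|rho_softmax k u| <= B * `|u ^+ 2| by near: u.
have hleu : forall l, (l <= K)%N -> forall k, (k <= K)%N ->
    (k <= l)%N -> gammaMM k u <= gammaMM l u by near: u.
split.
- move=> k kK; rewrite h0u//=; have := hgu k kK.
  by rewrite (gtr0_norm u0); exact: le_trans (ler_norm _).
- by move=> k l kl lK; apply: hleu => //; exact: leq_trans lK.
- have := hru 0%N (leqnn _); rewrite normrX (gtr0_norm u0).
  exact: le_trans (ler_norm _).
- move=> k kK; have := hsu k kK; rewrite normrX (gtr0_norm u0).
  exact: le_trans (ler_norm _).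
Unshelve. all: by end_near. Qed.

(** * Explicit error factors of the algorithm *)

(** [gamma 2 uq = 2 uq + 4 uq^2 / (1 - 2 uq)] with denominator at least 1/2. It is also at most
    [4 uq], so the cross term adds at most [4 B uq^2]. *)
Lemma mm_constant_bounds (R : realType) (gammaMM : nat -> R -> R) (B ua uq : R) (k : nat) :
  0 < uq -> uq <= 4^-1 -> ua <= uq -> 0 < B -> 0 <= gammaMM k ua <= B * ua ->
  mm_constant gammaMM ua uq k <= gammaMM k ua + 2 * uq + (8 + 4 * B) * uq ^+ 2.
Proof.
move=> u0 u1 au B0 /andP[g0 g1]; rewrite /mm_constant /gamma.
set g := gammaMM k ua in g0 g1 *; set G := _ / _.
have d0 : 0 < 1 - 2 * uq by lra.
have G0 : 0 <= G by rewrite divr_ge0// ltW// mulr_gt0.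
have G1 : G <= 2 * uq + 8 * uq ^+ 2.
  by rewrite ler_pdivrMr//; nra.
have G2 : G <= 4 * uq.
  by apply: le_trans G1 _; nra.
have gG : g * G <= B * uq * (4 * uq).
  by apply: ler_pM => //; apply: le_trans g1 _; rewrite ler_wpM2l// ltW.
lra.
Qed.

Definition product_bound (R : realType) (B u g : R) : R :=
  g + 2 * u + (8 + 4 * B) * u ^+ 2.

Lemma first_order_product (R : realType) (B u g : R) :
  0 < B -> 0 < u -> 0 <= g <= B * u ->
  first_order (8 + 4 * B) u (product_bound B u g) (g + 2 * u).
Proof.
move=> B0 u0 /andP[g0 g1].
have Bu := mulr_gt0 B0 u0.
have Bu2 := mulr_ge0 (ltW B0) (sqr_ge0 u); have u2 := sqr_ge0 u.
by split; rewrite ?/product_bound; lra.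
Qed.

(** Nested as the error factors are: 1 for the scaling, [8 + 4 * B] for a matrix product, [4 + B]
    for a rotation. *)
Definition scores_constant (R : realType) (B : R) : R :=
  let BRope := compound (8 + 4 * B) (4 + B) in
  compound 1 (compound (8 + 4 * B) (compound BRope BRope)).

Lemma scores_constant_ge0 (R : realType) (B : R) : 0 <= B -> 0 <= scores_constant B.
Proof.
move=> B0.
have B1 : 0 <= 8 + 4 * B by lra.
have B2 : 0 <= 4 + B by lra.
by rewrite /scores_constant !compound_ge0.
Qed.

(** The count behind [Delta]: two projections and one inner product give [6 u + 2 gd + gh], two
    rotations [4 u + 4 ua], the scaling [ua]. *)
Lemma first_order_scores (R : realType) (B u ua gd gh : R) :
  0 < B -> 0 < u -> u <= 1 -> 0 <= ua -> ua <= u ->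
  0 <= gd <= B * u -> 0 <= gh <= B * u ->
  first_order (scores_constant B) u
    ((1 + ua) * ((1 + product_bound B u gh)
      * ((1 + product_bound B u gd)
         * (1 + (2 * u + 2 * ua + B * u ^+ 2))) ^+ 2) - 1)
    (10 * u + 5 * ua + gh + 2 * gd).
Proof.
move=> B0 u0 u1 a0 au hgd hgh.
have u01 : 0 <= u <= 1 by rewrite ltW.
have B1 : 0 <= 8 + 4 * B by lra.
have B2 : 0 <= 4 + B by lra.
have fd := first_order_product B0 u0 hgd; have fh := first_order_product B0 u0 hgh.
have fr : first_order (4 + B) u (2 * u + 2 * ua + B * u ^+ 2) (2 * u + 2 * ua).
  have Bu := mulr_gt0 B0 u0.
  have Bu2 := mulr_ge0 (ltW B0) (sqr_ge0 u); have u2 := sqr_ge0 u.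
  by split; lra.
have fa : first_order 1 u ua ua by split=> //; [rewrite lerDl mul1r sqr_ge0 | rewrite mul1r].
have fdr := first_orderM B1 B2 u01 fd fr.
have B3 := compound_ge0 B1 B2.
have fdr2 := first_orderM B3 B3 u01 fdr fdr.
have B4 := compound_ge0 B3 B3.
have fs := first_orderM B1 B4 u01 fh fdr2.
have := first_orderM ler01 (compound_ge0 B1 B4) u01 fa fs.
rewrite -/(scores_constant B); congr (first_order _ _ _ _); last by ring.
by ring.
Qed.

Definition total_constant (R : realType) (B BQ : R) : R :=
  compound (compound (compound (8 + 4 * B) BQ) (8 + 4 * B)) (8 + 4 * B).

(** The three matrix products, for the values, the average and [WO], give [6 u + 2 gd + gN]; the
    attention weights add [q]. *)
Lemma first_order_total (R : realType) (B BQ u gd gN Q q : R) :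
  0 < B -> 0 <= BQ -> 0 < u -> u <= 1 -> 0 <= gd <= B * u -> 0 <= gN <= B * u ->
  first_order BQ u Q q ->
  (1 + ((1 + product_bound B u gd) * (1 + Q) * (1 + product_bound B u gN) - 1))
      * (1 + product_bound B u gd) - 1
    <= 6 * u + 2 * gd + gN + q + total_constant B BQ * u ^+ 2.
Proof.
move=> B0 BQ0 u0 u1 hgd hgN fQ.
have u01 : 0 <= u <= 1 by rewrite ltW.
have B1 : 0 <= 8 + 4 * B by lra.
have fd := first_order_product B0 u0 hgd.
have fn := first_order_product B0 u0 hgN.
have f1 := first_orderM B1 BQ0 u01 fd fQ.
have B2 := compound_ge0 B1 BQ0.
have f2 := first_orderM B2 B1 u01 f1 fn.
have B3 := compound_ge0 B2 B1.
have [_ + _] := first_orderM B3 B1 u01 f2 fd.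
rewrite -/(total_constant B BQ).
move: (product_bound B u gd) (product_bound B u gN) => ed en.
rewrite ![1 + (_ - 1)]addrC !subrK => /le_trans; apply; lra.
Qed.

Lemma scores_error_linear (R : realType) (BE gm g E x u : R) :
  0 <= E -> E <= 2 * BE * u -> 0 <= g <= gm ->
  E * (g * x ^+ 2) <= 2 * BE * gm * x ^+ 2 * u.
Proof.
move=> E0 EB /andP[g0 ggm].
rewrite [leRHS](_ : _ = 2 * BE * u * (gm * x ^+ 2)); last by ring.
apply: ler_pM => //; first exact: mulr_ge0 g0 (sqr_ge0 x).
by rewrite ler_wpM2r ?sqr_ge0.
Qed.

(** The first-order part keeps [k * g * f] together, since [M] is to be a maximum of products over
    the heads; in the second-order terms [k] and [g] may be replaced by the separate bounds [km] and
    [gm]. *)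
Lemma softmax_error_le (R : realType) (BE km gm k g E f M x u : R) :
  0 <= BE -> 0 <= E -> E <= f + BE * u ^+ 2 -> E <= 2 * BE * u ->
  0 <= k <= km -> 0 <= g <= gm -> 0 <= u -> k * g * f <= M ->
  k * (E * (g * x ^+ 2)) + 16 * (E * (g * x ^+ 2)) ^+ 2
    <= M * x ^+ 2 + (km * gm * x ^+ 2 * BE + 16 * (2 * BE * gm * x ^+ 2) ^+ 2) * u ^+ 2.
Proof.
move=> BE0 E0 Ef EB /andP[k0 kkm] /[dup] hg /andP[g0 ggm] u0 kgM.
have x20 : 0 <= x ^+ 2 by exact: sqr_ge0.
have u20 : 0 <= u ^+ 2 by exact: sqr_ge0.
have gm0 := le_trans g0 ggm; have gx0 := mulr_ge0 g0 x20.
have d2 : (E * (g * x ^+ 2)) ^+ 2 <= (2 * BE * gm * x ^+ 2) ^+ 2 * u ^+ 2.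
  rewrite -exprMn lerXn2r ?nnegrE ?scores_error_linear//; first exact: mulr_ge0.
  exact: mulr_ge0 (mulr_ge0 (mulr_ge0 (mulr_ge0 _ _) _) _) _.
rewrite [X in _ <= _ + X]mulrDl addrA -[X in _ <= _ + X]mulrA lerD ?ler_wpM2l//.
apply: (@le_trans _ _ (k * g * f * x ^+ 2 + k * g * (x ^+ 2 * (BE * u ^+ 2)))).
  rewrite [leRHS](_ : _ = k * ((f + BE * u ^+ 2) * (g * x ^+ 2))); last by ring.
  by rewrite ler_wpM2l// ler_wpM2r.
rewrite lerD ?ler_wpM2r//.
rewrite [leRHS](_ : _ = km * gm * (x ^+ 2 * (BE * u ^+ 2))); last by ring.
apply: ler_pM; [exact: mulr_ge0 | | exact: ler_pM | by []].
exact: mulr_ge0 x20 (mulr_ge0 BE0 u20).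
Qed.


Lemma DeltaE (R : realType) (gammaMM : nat -> R -> R) (ua uq : R) (nhead dhead : nat)
    (WQ WK : 'M[R]_(nhead * dhead)) (h : 'I_nhead) :
  Delta gammaMM ua uq WQ WK h =
  2 * (Num.sqrt dhead%:R)^-1
    * opnorm +oo 2%:E (mxabs (row_block WK h)) * opnorm +oo 2%:E (mxabs (row_block WQ h))
  * (10 * uq + 5 * ua + gammaMM dhead ua + 2 * gammaMM (nhead * dhead)%N ua).
Proof.
rewrite /Delta; move: (opnorm +oo _ (mxabs (row_block WK h))) => NK.
move: (opnorm +oo _ _) (10 * _ + _ + _ + _) (_^-1) => NQ f c.
ring.
Qed.

(** * Assembly of the final bound *)

Theorem theorem6p3 (R : realType) (tau nhead dhead N : nat)
    (htau : (0 < tau)%N) (hnhead : (0 < nhead)%N)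
    (hdhead : (0 < dhead)%N) (hdhead_even : ~~ odd dhead) (hN : (0 < N)%N)
    (WQ WK WV WO : 'M[R]_(nhead * dhead)) (X : 'M[R]_(nhead * dhead, N))
    (gammaMM : nat -> R -> R) (hgammaMM : summation_constant gammaMM)
    (rho_rope : R -> R) (hrho_rope : second_order rho_rope)
    (rho_softmax : nat -> R -> R)
    (hrho_softmax : forall n, second_order (rho_softmax n)) :
  exists2 rho : R -> R,
    (rho : R -> R^o) =O_ (0^'+)
      ((fun u => u ^+ 2 + u ^+ 2 * opnorm 1%:E +oo X ^+ 2) : R -> R^o) &
    \forall uq \near 0^'+, forall uw ua : R, 0 < uw -> uw <= ua -> ua <= uq ->
    forall Y : 'M[R]_(nhead * dhead, N),
      fl_attention gammaMM rho_rope rho_softmax uw ua uq tau WQ WK WV WO X Y ->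
      opnorm 1%:E +oo (Y - attention tau WQ WK WV WO X) <=
        (6 * uq + 2 * gammaMM (nhead * dhead)%N ua + gammaMM N ua
         + 3 * uw + gammaMM N uw
         + \big[Num.max/0]_(h < nhead)
             (kappa_softmax tau WQ WK X h * Delta gammaMM ua uq WQ WK h)
           * opnorm 1%:E +oo X ^+ 2
         + rho uq)
        * opnorm +oo +oo WO
        * \big[Num.max/0]_(h < nhead) opnorm +oo +oo (row_block WV h)
        * opnorm 1%:E +oo X.
Proof.
(* [K] dominates every inner dimension that occurs. *)
pose d := (nhead * dhead)%N; pose K := (d + dhead + N)%N.
have [dK dhK NK] : [/\ (d <= K)%N, (dhead <= K)%N & (N <= K)%N].
  by rewrite /K; split; [rewrite -addnA leq_addr | rewrite addnAC leq_addl | rewrite leq_addl].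
have [B B0 hB] := model_bounds K hgammaMM hrho_rope hrho_softmax.
set x := opnorm 1%:E +oo X; set mu := \big[Num.max/0]_(h < nhead) opnorm _ _ _.
have x0 : 0 <= x by rewrite opnorm_ge0 ?lte01 ?ltry.
have Xx i j : `|X i j| <= x by exact: entry_le_opnorm.
have mu0 : 0 <= mu by exact: bigmax_ge_id.
pose kappa h := kappa_softmax tau WQ WK X h.
pose g (h : 'I_nhead) := 2 * (Num.sqrt dhead%:R)^-1
  * opnorm +oo 2%:E (mxabs (row_block WK h)) * opnorm +oo 2%:E (mxabs (row_block WQ h)).
pose km := \big[Num.max/0]_h kappa h; pose gm := \big[Num.max/0]_h g h.
have k0 h : 0 <= kappa h by exact: bigmax_ge_id.
have two0 : (0 < 2%:E :> \bar R)%E by rewrite lte_fin.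
have g0 h : 0 <= g h.
  by rewrite /g !mulr_ge0 ?invr_ge0 ?sqrtr_ge0 ?opnorm_ge0 ?ltry.
have km0 : 0 <= km by exact: bigmax_ge_id.
have gm0 : 0 <= gm by exact: bigmax_ge_id.
have kkm h : kappa h <= km by exact: le_bigmax.
have ggm h : g h <= gm by exact: le_bigmax.
pose BE := scores_constant B; have BE0 : 0 <= BE := scores_constant_ge0 (ltW B0).
(* Dominates both parts of the weight error: to first order [(3 + B) u] plus the [kappa] term, to
   second order [B] from [rho_softmax] and the remainder of [softmax_error_le]. *)
pose BQ := 4 + B + km * gm * x ^+ 2 * BE + 16 * (2 * BE * gm * x ^+ 2) ^+ 2.
have kgx0 : 0 <= km * gm * x ^+ 2 * BE by rewrite !mulr_ge0// exprn_ge0.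
have BQ0 : 0 <= BQ.
  by rewrite /BQ !addr_ge0// ?(ltW B0)// mulr_ge0// sqr_ge0.
(* The constant may depend on [X], as the limit is in [u] alone. *)
exists (fun u => total_constant B BQ * u ^+ 2).
  apply/eqOP; near=> k; near=> u.
  rewrite /= normrM ler_pM//.
  rewrite [leRHS]ger0_norm ?addr_ge0 ?mulr_ge0 ?sqr_ge0//.
  by rewrite [leLHS]ger0_norm ?sqr_ge0// lerDl mulr_ge0 ?sqr_ge0.
near=> u => uw ua uw0 uwa au Y [a [ha hY]].
have u0 : 0 < u by near: u; exact: nbhs_right_gt.
have u4 : u <= 4^-1 by near: u; apply: nbhs_right_le; rewrite invr_gt0.
(* Makes the score error [delta] at most 1/2, as the softmax expansion requires; the added 1 keeps
   the denominator positive. *)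
have udelta : u <= (4 * BE * gm * x ^+ 2 + 1)^-1.
  near: u; apply: nbhs_right_le; rewrite invr_gt0.
  by rewrite ltr_wpDl// !mulr_ge0 ?sqr_ge0.
have hBu : forall v, 0 < v -> v <= u ->
    [/\ forall k, (k <= K)%N -> 0 <= gammaMM k v <= B * v,
        forall k l, (k <= l)%N -> (l <= K)%N -> gammaMM k v <= gammaMM l v,
        rho_rope v <= B * v ^+ 2
      & forall k, (k <= K)%N -> rho_softmax k v <= B * v ^+ 2] by near: u.
have ua0 : 0 < ua := lt_le_trans uw0 uwa; have uwu := le_trans uwa au.
have u1 : u <= 1 by apply: le_trans u4 _; rewrite invf_le1// ler1n.
have [ga gale _ _] := hBu _ ua0 au.
have [gw gwle _ sw] := hBu _ uw0 uwu.
have [_ _ rr _] := hBu _ u0 (lexx u).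
have gau k : (k <= K)%N -> 0 <= gammaMM k ua <= B * u.
  by move=> /ga /andP[-> /=] /le_trans; apply; rewrite ler_wpM2l// ltW.
pose em k := product_bound B u (gammaMM k ua).
have em0 k : (k <= K)%N -> 0 <= em k.
  by move=> kK; have [] := first_order_product B0 u0 (gau k kK).
have emP k : (k <= K)%N -> mm_constant gammaMM ua u k <= em k.
  by move=> kK; exact: mm_constant_bounds (ga k kK).
pose er := 2 * u + 2 * ua + B * u ^+ 2.
have er0 : 0 <= er by rewrite /er !addr_ge0 ?mulr_ge0 ?sqr_ge0// ltW.
pose E := (1 + ua) * ((1 + em dhead) * ((1 + em d) * (1 + er)) ^+ 2) - 1.
pose fE := 10 * u + 5 * ua + gammaMM dhead ua + 2 * gammaMM d ua.
have fo : first_order BE u E fE.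
  exact: first_order_scores B0 u0 u1 (ltW ua0) au (gau d dK) (gau dhead dhK).
have [E0 EfE fEB] := fo.
have EB : E <= 2 * BE * u by apply: first_order_linear fo => //; rewrite ltW.
pose es := 3 * uw + gammaMM N uw + B * u ^+ 2.
set M := \big[Num.max/0]_(h < nhead) _.
have kD h : kappa h * Delta gammaMM ua u WQ WK h = kappa h * g h * fE.
  by rewrite DeltaE; exact: mulrA.
have MfE h : kappa h * g h * fE <= M.
  by rewrite -kD /M (le_bigmax _ (fun h => kappa_softmax tau WQ WK X h * Delta gammaMM ua u WQ WK h)).
(* [q] is the announced first-order part of the l_1 error of the attention weights; [Q] adds
   second-order slack and serves all heads and positions. *)
pose q := 3 * uw + gammaMM N uw + M * x ^+ 2.
pose Q := q + BQ * u ^+ 2.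
have M0 : 0 <= M by exact: bigmax_ge_id.
have x20 : 0 <= x ^+ 2 by exact: sqr_ge0.
have u20 : 0 <= u ^+ 2 by exact: sqr_ge0.
have /andP[gN0 gN1] := gw N NK.
have q0 : 0 <= q by rewrite /q !addr_ge0 ?mulr_ge0// ltW.
have gNu : gammaMM N uw <= B * u by apply: le_trans gN1 _; rewrite ler_wpM2l// ltW.
(* [M] is [O(u)], because [kappa] and [g] have bounds independent of [u]. *)
have Mx : M * x ^+ 2 <= km * gm * x ^+ 2 * BE * u.
  rewrite [leRHS](_ : _ = km * gm * (BE * u) * x ^+ 2); last by ring.
  rewrite ler_wpM2r// /M; apply: bigmax_le => [|h _].
    by rewrite !mulr_ge0// ltW.
  rewrite -/(kappa h) kD; apply: (@le_trans _ _ (kappa h * g h * (BE * u))).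
    by rewrite ler_wpM2l// mulr_ge0.
  by rewrite ler_wpM2r ?ler_pM// mulr_ge0// ltW.
have sq16 : 0 <= 16 * (2 * BE * gm * x ^+ 2) ^+ 2 * u by rewrite !mulr_ge0 ?sqr_ge0// ltW.
have fQ : first_order BQ u Q q.
  split; [by rewrite addr_ge0// mulr_ge0 | by [] |].
  move: Mx sq16; rewrite /q /BQ; move: (M * _) (km * _ * _ * _) (16 * _) => y1 y2 y3.
  by clear -gNu uwu u0; lra.
have Q0 : 0 <= Q by case: fQ.
have heads h n : perturb ((1 + em d) * (1 + Q) * (1 + em N) - 1) (const_mx (mu * x))
    (head_output tau (row_block WQ h) (row_block WK h) (row_block WV h) X n) (a h n).
  have [Qc [Kc [V [RQ [RK [s [b [p [hQ [hK [hV [hRQ [hRK hn]]]]]]]]]]]]] := ha h.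
  have [hs hb hp hout] := hn n.
  (* Position [n] averages over [n.+1] entries; monotonicity of [gammaMM] replaces this length by
     [N]. *)
  have nN : (n.+1 <= N)%N by exact: ltn_ord.
  pose delta := E * (g h * x ^+ 2).
  have gx0 : 0 <= g h * x ^+ 2 by rewrite mulr_ge0.
  have delta0 : 0 <= delta by rewrite mulr_ge0.
  have hkm : 0 <= kappa h <= km by rewrite k0 kkm.
  have hgm : 0 <= g h <= gm by rewrite g0 ggm.
  have deltaB : delta <= 2 * BE * gm * x ^+ 2 * u by exact: scores_error_linear.
  have delta1 : delta <= 2^-1.
    apply: le_trans deltaB _.
    have : u * (4 * BE * gm * x ^+ 2 + 1) <= 1.
      by rewrite -ler_pdivlMr ?mul1r// ltr_wpDl// !mulr_ge0.
    by clear -u0; move: (x ^+ 2) => y; clearbody BE gm; lra.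
  have hscores t : `|b n t 0 - scores tau (row_block WQ h) (row_block WK h) X n t 0| <= delta.
    apply: (scores_error (em0 d dK) er0 (em0 dhead dhK) (ltW ua0) x0 Xx _ _ _ _ _ hb).
    - exact: product_within_le (emP d dK) hQ.
    - exact: product_within_le (emP d dK) hK.
    - by move=> k; apply: product_within_le (hRQ k); rewrite lerD2l.
    - by move=> k; apply: product_within_le (hRK k); rewrite lerD2l.
    - exact: product_within_le (emP dhead dhK) hs.
  have hkappa : opnorm +oo 1%:E (softmax_jacobian
      (scores tau (row_block WQ h) (row_block WK h) X n)) <= kappa h.
    by rewrite /kappa /kappa_softmax (le_bigmax _ (fun n => opnorm +oo 1%:E
      (softmax_jacobian (scores tau (row_block WQ h) (row_block WK h) X n)))).
  have hmu : opnorm +oo +oo (row_block WV h) <= mu.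
    by rewrite /mu (le_bigmax _ (fun h => opnorm +oo +oo (row_block WV h))).
  have hp' t : `|p n t 0 - softmax (b n) t 0| <= es * softmax (b n) t 0.
    apply: le_trans (hp t) _; rewrite ler_wpM2r ?softmax_ge0//.
    rewrite /es !lerD//; first exact: gwle.
    apply: le_trans (sw _ (leq_trans nN NK)) _.
    apply: ler_wpM2l; first exact: ltW.
    by apply: lerXn2r => //; rewrite nnegrE ltW.
  have emn : em n.+1 <= em N by rewrite /em /product_bound !lerD2r gale.
  have hout' := product_within_le (le_trans (emP _ (leq_trans nN NK)) emn) hout.
  have hV' := product_within_le (emP d dK) hV.
  pose qh := es + (kappa h * delta + 16 * delta ^+ 2).
  have := head_error (em0 d dK) (em0 N NK) x0 Xx hmu hkappa delta1 hscores hV' hp' hout'.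
  rewrite -/qh.
  have es0 : 0 <= es by rewrite /es !addr_ge0 ?mulr_ge0// ltW.
  have qh0 : 0 <= qh := addr_ge0 es0 (addr_ge0 (mulr_ge0 (k0 h) delta0) (mulr_ge0 (ler0n _ 16) (sqr_ge0 delta))).
  have qhQ : qh <= Q.
    have := softmax_error_le x BE0 E0 EfE EB hkm hgm (ltW u0) (MfE h).
    rewrite -/delta /qh /Q /q /es /BQ.
    move: (M * _) (km * _ * _ * _) (16 * (_ * _) ^+ 2) (kappa h * delta + _) => y1 y2 y3 y4.
    by clear -u20; lra.
  apply: perturb_le => //.
    by rewrite subr_ge0 !mulr_ege1 ?lerDl// em0.
  rewrite lerD2r; apply: ler_wpM2r; first by rewrite addr_ge0 ?em0.
  by apply: ler_wpM2l; [rewrite addr_ge0 ?em0 | rewrite lerD2l].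
have e0 : 0 <= (1 + em d) * (1 + Q) * (1 + em N) - 1.
  by rewrite subr_ge0 !mulr_ege1 ?lerDl// em0.
have hY' := product_within_le (emP d dK) hY.
apply: le_trans (attention_error e0 (em0 d dK) (mulr_ge0 mu0 x0) heads hY') _.
rewrite mulrA ler_wpM2r// ler_wpM2r// ler_wpM2r ?opnorm_ge0 ?ltry//.
apply: le_trans (first_order_total B0 BQ0 u0 u1 (gau d dK) (gau N NK) fQ) _.
by rewrite /q !addrA.
Unshelve. all: by end_near. Qed.
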